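(* Let $d\ge2$ be an integer. There exist constants $C,c>0$, a family of functions $g_\varepsilon=g_\varepsilon(x)\in C_c^\infty(\mathbb{R}^d)$, $0<\varepsilon<1/10$, and smooth stationary solutions $f_\varepsilon=f_\varepsilon(x,v)$ of $$(\partial_t+v\cdot\nabla_x)f_\varepsilon=\Delta_v f_\varepsilon+g_\varepsilon\qquad\text{in }\mathbb{R}_t\times\mathbb{R}_x^d\times\mathbb{R}_v^d,$$ where $g_\varepsilon$ is independent of $v$, such that for every $0<\varepsilon<1/10$ $$\|g_\varepsilon\|_{L^\infty(\mathbb{R}^d)}\le1,\qquad \|f_\varepsilon\|_{L^\infty(\mathbb{R}^d\times\mathbb{R}^d)}\le C,$$ but $$\|D_v^2f_\varepsilon\|_{L^\infty(B_{1/4}\times B_{1/4})}\ge c\log\frac1\varepsilon.$$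
   Context: Points are written $(t,x,v)\in\mathbb{R}\times\mathbb{R}^d\times\mathbb{R}^d$. $B_r\subset\mathbb{R}^d$ is the ball of radius $r$ centered at the origin. A stationary solution is one that does not depend on $t$. $D_v^2 f$ is the $d\times d$ Hessian matrix of $f$ in $v$, measured pointwise in the Frobenius norm $|M|=(\sum_{i,j}|M_{ij}|^2)^{1/2}$, and $\Delta_v$ is the Laplacian in $v$. The set $B_{1/4}\times B_{1/4}$ refers to $(x,v)\in\mathbb{R}^d\times\mathbb{R}^d$. The constants $C,c$ do not depend on $\varepsilon$. *)

(* Defs.v *)
From HB Require Import structures.
From mathcomp Require Import all_boot all_order all_algebra.
From mathcomp Require Import all_classical all_reals all_analysis.

Set Implicit Arguments.
Unset Strict Implicit.
Unset Printing Implicit Defensive.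

Import Order.TTheory GRing.Theory Num.Theory.
Import numFieldNormedType.Exports.

Local Open Scope classical_set_scope.
Local Open Scope ring_scope.

(* Lebesgue measure on R^n, as the n-fold product of Lebesgue measure on R.
   lebesgue_measure_tuple_rect characterizes it by its values on rectangles. *)

Definition tuple_cons (T : Type) (n : nat) (p : n.-tuple T * T) : n.+1.-tuple T :=
  [tuple of p.2 :: p.1].

Lemma measurable_tuple_cons (d : measure_display) (T : measurableType d) (n : nat) :
  measurable_fun [set: n.-tuple T * T] (@tuple_cons T n).
Proof. exact: measurable_cons measurable_snd measurable_fst. Qed.

Definition lebesgue_cons (R : realType) (n : nat)
    (mu : {measure set (n.-tuple (measurableTypeR R)) -> \bar R}) :
    set (n.+1.-tuple (measurableTypeR R)) -> \bar R :=
  pushforward (product_measure1 mu (@lebesgue_measure R))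
    (@tuple_cons (measurableTypeR R) n).

HB.instance Definition _ (R : realType) (n : nat)
    (mu : {measure set (n.-tuple (measurableTypeR R)) -> \bar R}) :=
  Measure.copy (lebesgue_cons mu)
    (measure_function_pushforward__canonical__measure_function_Measure
       (product_measure1 mu (@lebesgue_measure R))
       (@measurable_tuple_cons _ (measurableTypeR R) n)).

Fixpoint lebesgue_measure_tuple (R : realType) (n : nat) :
    {measure set (n.-tuple (measurableTypeR R)) -> \bar R} :=
  match n with
  | 0 => \d_[tuple]
  | m.+1 => lebesgue_cons (lebesgue_measure_tuple R m)
  end.

Lemma lebesgue_measure_tuple_rect (R : realType) (n : nat)
    (A : 'I_n -> set (measurableTypeR R)) :
  (forall i, measurable (A i)) ->
  lebesgue_measure_tuple R n [set t | forall i, A i (tnth t i)] =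
  (\prod_(i < n) lebesgue_measure (A i))%E.
Proof.
elim: n A => [|n IHn] A mA.
  by rewrite big_ord0 /= diracE mem_set//= => -[].
pose B := [set t : n.-tuple (measurableTypeR R) |
  forall i, A (lift ord0 i) (tnth t i)].
have mB : measurable B.
  rewrite (_ : B = \bigcap_i ((@tnth n _)^~ i @^-1` A (lift ord0 i))).
    apply: fin_bigcap_measurable => // i _; rewrite -[X in measurable X]setTI.
    exact: measurable_tnth.
  by apply/seteqP; split => t /= Bt i; [move=> _|]; exact: Bt.
have AB : @tuple_cons (measurableTypeR R) n @^-1`
    [set t | forall i, A i (tnth t i)] = B `*` A ord0.
  apply/seteqP; split=> -[t x] /=.
    move=> At; split; first by move=> i; have := At (lift ord0 i); rewrite tnthS.
    by have := At ord0; rewrite tnth0.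
  by move=> [Bt Ax] i; case: (unliftP ord0 i) => [j|] ->; rewrite ?tnthS ?tnth0.
rewrite big_ord_recl muleC -IHn; last by move=> i; exact: mA.
rewrite [LHS]/= /lebesgue_cons /pushforward AB.
exact: product_measure1E.
Qed.

Definition tuple_row (R : realType) (n : nat)
    (t : n.-tuple (measurableTypeR R)) : 'rV[R]_n := \row_i tnth t i.

(* The L^oo norm of u on A with respect to Lebesgue measure; u is extended by 0
   outside A. *)
Definition Linfty_norm (R : realType) (n : nat) (A : set 'rV[R]_n)
    (u : 'rV[R]_n -> R) : \bar R :=
  Lnorm (lebesgue_measure_tuple R n) +oo%E
    (fun t => ((u \_ A) (tuple_row t))%:E).

Definition row_pair (R : realType) (d : nat) (z : 'rV[R]_(d + d)) :
  'rV[R]_d * 'rV[R]_d := (lsubmx z, rsubmx z).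

(* The same on R^d x R^d, identified with R^(d + d). *)
Definition Linfty_norm2 (R : realType) (d : nat)
    (A : set ('rV[R]_d * 'rV[R]_d)) (u : 'rV[R]_d * 'rV[R]_d -> R) : \bar R :=
  Linfty_norm (@row_pair R d @^-1` A) (u \o @row_pair R d).

(* The norm of 'M[R]_(m, n) in the library is the maximum norm: it gives the
   right topology, but not the balls and the pointwise norm needed here. *)
Definition frobenius_norm (R : realType) (m n : nat) (M : 'M[R]_(m, n)) : R :=
  Num.sqrt (\sum_i \sum_j `|M i j| ^+ 2).

Definition euclidean_ball (R : realType) (d : nat) (r : R) : set 'rV[R]_d :=
  [set x : 'rV[R]_d | Num.sqrt (\sum_i x 0 i ^+ 2) < r].

(* Only used with V finite-dimensional, where it is the usual C^k. *)
Fixpoint Ck (R : realType) (V : normedModType R) (k : nat) (f : V -> R) : Prop :=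
  match k with
  | 0 => continuous f
  | j.+1 => (forall x, differentiable f x) /\ forall u, Ck j ('D_u f)
  end.

Definition smooth (R : realType) (V : normedModType R) (f : V -> R) : Prop :=
  forall k, Ck k f.

Definition compactly_supported (R : realType) (V : normedModType R)
    (f : V -> R) : Prop :=
  compact (closure [set x | f x != 0]).

Definition partial (R : realType) (d : nat) (i : 'I_d) (h : 'rV[R]_d -> R) :
  'rV[R]_d -> R := 'D_(delta_mx 0 i) h.

Definition gradient (R : realType) (d : nat) (h : 'rV[R]_d -> R)
    (x : 'rV[R]_d) : 'rV[R]_d := \row_i partial i h x.

Definition hessian (R : realType) (d : nat) (h : 'rV[R]_d -> R)
    (x : 'rV[R]_d) : 'M[R]_d := \matrix_(i, j) partial i (partial j h) x.

Definition laplacian (R : realType) (d : nat) (h : 'rV[R]_d -> R)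
    (x : 'rV[R]_d) : R := \sum_i partial i (partial i h) x.

Definition dot (R : realType) (d : nat) (u w : 'rV[R]_d) : R :=
  \sum_i u 0 i * w 0 i.

(* (d_t + v . grad_x) F = Delta_v F + G at every (t, x, v), with F and G
   functions of (t, (x, v)). *)
Definition kinetic_solution (R : realType) (d : nat)
    (F G : R * ('rV[R]_d * 'rV[R]_d) -> R) : Prop :=
  forall t x v,
    derive1 (fun s => F (s, (x, v))) t +
    dot v (gradient (fun y => F (t, (y, v))) x) =
    laplacian (fun w => F (t, (x, w))) v + G (t, (x, v)).

(* Main.v *)
From HB Require Import structures.
Require Import Defs.
From mathcomp Require Import all_boot all_order all_algebra.
From mathcomp Require Import all_classical all_reals all_analysis.
From mathcomp Require Import measurable_realfun ess_sup_inf.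
From mathcomp Require Import ring lra.

Import Order.TTheory GRing.Theory Num.Theory.
Import numFieldNormedType.Exports.

Local Open Scope classical_set_scope.
Local Open Scope ring_scope.

(** If [g] is a bounded function of [x] with compact support, and [P_t] is the
    heat semigroup on [R^d], then
      [f (x, v) = int_0^oo (P_(s^3/3) g) (x - s v) ds]
    is a stationary solution with source [g]: the [s]-derivative of
    [(P_(s^3/3) g) (x - s v)] is [s^2 Delta - v . grad] applied to it, that is, the
    integrand of [Delta_v f - v . grad_x f], and it integrates to [- g (x)]. At
    [v = 0] the Hessian of [f] in [v] is [int_0^oo s^2 (D^2 P_(s^3/3) g) ds], a
    singular integral of order zero of [g], whose off-diagonal entries are not
    bounded by the supremum of [g].

    To see the logarithm, one fixed source [G] is enough, supported away from
    the origin and such that the mixed derivative [theta] of its solution [F] in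
    [v_0] and [v_1] at the origin is positive. The functions
    [4^-k F (8^k x, 2^k v)] solve the equation with the sources [G (8^k x)], which
    have disjoint supports, and have the same mixed derivative [theta] at the
    origin. The sum over [k < N] thus has a source bounded independently of [N], is
    bounded because the factors [4^-k] are summable, and has mixed derivative
    [N theta] at the origin. It remains to take [N] larger than [ln (1 / eps)], and
    to multiply by a constant [delta] which makes the source at most [1].

    The source [G] is a tensor product of derivatives of a smooth bump [b]
    supported in [[1, 2]]. The semigroup then acts coordinatewise ([heat]), by
    averaging over a Gaussian variable, and positivity of [theta]
    ([mixed_potential_gt0]) follows by moving the derivatives from [b] to the
    Gaussian. With [s = r^2] as the variable of integration everything is smooth in
    [r >= 0]. Each derivative of the heat evolution gains a factor
    [1 / (1 + r^2)] ([heat_bound]), which compensates for the factor [r^2] brought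
    out by a derivative in [v]; so all the derivatives of [F] are integrals
    ([potential]) with integrands dominated by [1 / (1 + r^2)]. That they are the
    derivatives is read off a second-order Taylor estimate of the integrands,
    uniform in [r] ([potential_taylor]), which gives differentiability in the
    Frechet sense with no need of continuity of partial derivatives. *)

(** * Derivatives on the line *)

Section Derivatives.
Context {R : realType}.
Implicit Types (f g : R -> R) (x a : R).

Lemma is_derive_addf {f g x df dg} : is_derive x 1 f df -> is_derive x 1 g dg ->
  is_derive x 1 (fun y => f y + g y) (df + dg).
Proof. by move=> Hf Hg; have := is_deriveD Hf Hg. Qed.

Lemma is_derive_mulf {f g x df dg} : is_derive x 1 f df -> is_derive x 1 g dg ->
  is_derive x 1 (fun y => f y * g y) (df * g x + f x * dg).
Proof.
move=> Hf Hg; have := is_deriveM Hf Hg.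
by rewrite /GRing.scale/= [g x * _]mulrC addrC.
Qed.

Lemma is_derive_scalef {f x df} a : is_derive x 1 f df ->
  is_derive x 1 (fun y => a * f y) (a * df).
Proof. by move=> Hf; have := is_deriveZ a Hf. Qed.

Lemma is_derive_val {f x df dg} : is_derive x 1 f df -> df = dg ->
  is_derive x 1 f dg.
Proof. by move=> + <-. Qed.

Lemma is_derive_fun {f g x df} : f =1 g -> is_derive x 1 f df ->
  is_derive x 1 g df.
Proof. by move=> /funext ->. Qed.

Lemma is_derive_affine {f x df} a b : is_derive (a * x + b) 1 f df ->
  is_derive x 1 (fun y => f (a * y + b)) (a * df).
Proof.
move=> Hf; have Ha : is_derive x 1 (fun y => a * y + b) a.
  apply: is_derive_val (is_derive_addf (is_derive_scalef a (is_derive_id x 1)) (is_derive_cst b x 1)) _.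
  by rewrite mulr1 addr0.
have := @is_derive1_comp _ f (fun y => a * y + b) x df a Hf Ha.
by rewrite /GRing.scale/= mulrC.
Qed.

Lemma is_derive_continuous {f} {df : R -> R} :
  (forall x, is_derive x 1 f (df x)) -> continuous f.
Proof.
move=> Hf x; apply: differentiable_continuous.
by apply/derivable1_diffP; have [] := Hf x.
Qed.

Lemma mean_value {f} {df : R -> R} : (forall x, is_derive x 1 f (df x)) ->
  forall x y, x <= y -> exists2 c, x <= c <= y & f y - f x = df c * (y - x).
Proof.
move=> Hf x y xy.
have H w : w \in `]x, y[ -> is_derive w 1 f (df w) by [].
have cf : {within `[x, y], continuous f}.
  by apply: continuous_subspaceT; exact: is_derive_continuous Hf.
by have [c cxy E] := MVT_segment xy H cf; exists c => //; rewrite in_itv in cxy.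
Qed.

(** Second-order Taylor estimate. *)
Lemma taylor2 {f} {df ddf : R -> R} M :
  (forall x, is_derive x 1 f (df x)) -> (forall x, is_derive x 1 df (ddf x)) ->
  (forall x, `|ddf x| <= M) ->
  forall x h, `|f (x + h) - f x - h * df x| <= M * h ^+ 2.
Proof.
move=> Hf Hdf HM x h.
have lip y z : `|df y - df z| <= M * `|y - z|.
  wlog yz : y z / z <= y.
    by move=> H; case: (leP z y) => [/H//|/ltW/H]; rewrite distrC [in `|z - y|]distrC.
  have [c _ ->] := mean_value Hdf _ _ yz.
  by rewrite normrM ler_wpM2r.
have [c cx ->] : exists2 c, `|c - x| <= `|h| & f (x + h) - f x = df c * h.
  case: (lerP 0 h) => h0.
    have xh : x <= x + h by lra.
    have [c /andP[c1 c2] ->] := mean_value Hf _ _ xh.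
    by exists c; [rewrite !ger0_norm//; lra|congr (_ * _); ring].
  have xh : x + h <= x by lra.
  have [c /andP[c1 c2] E] := mean_value Hf _ _ xh; exists c.
    by rewrite !ler0_norm//; lra.
  by rewrite -[LHS]opprB E; ring.
rewrite [h * _]mulrC -mulrBl normrM.
rewrite (le_trans (ler_wpM2r _ (lip c x)))// -mulrA ler_wpM2l//.
  exact: le_trans (HM 0).
by rewrite -real_normK ?num_real// expr2 ler_wpM2r.
Qed.

(** A quadratic remainder gives a directional derivative. *)
Lemma is_derive_quadratic {V : normedModType R} {f : V -> R} {x u : V} {l : R} C :
  (forall h, `|h| <= 1 -> `|f (h *: u + x) - f x - h * l| <= C * h ^+ 2) ->
  is_derive x u f l.
Proof.
move=> H; have C0 : 0 <= C.
  by have := H 1; rewrite normr1 expr1n mulr1 lexx => /(_ isT); apply: le_trans.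
have L : h^-1 *: ((f \o shift x) (h *: u) - f x) @[h --> 0^'] --> l.
  apply/cvgrPdist_le => e e0; near=> h.
  have h0 : h != 0 by near: h; exact: nbhs_dnbhs_neq.
  have h1 : `|h| <= 1 by near: h; apply: dnbhs0_le.
  have hC : `|h| <= e / (C + 1) by near: h; apply: dnbhs0_le; rewrite divr_gt0//; lra.
  rewrite /= distrC.
  have -> : h^-1 *: (f (h *: u + x) - f x) - l = h^-1 * (f (h *: u + x) - f x - h * l).
    by rewrite /GRing.scale/=; field.
  rewrite normrM normfV ler_pdivrMl ?normr_gt0//.
  rewrite (le_trans (H _ h1))// -real_normK ?num_real// expr2 mulrCA ler_wpM2l//.
  rewrite ler_pdivlMr in hC; last by lra.
  by have := normr_ge0 h; nra.
by split; [apply/cvg_ex; exists l|exact: cvg_lim].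
Unshelve. all: by end_near. Qed.

End Derivatives.

(** * Integrals over the half-line *)

(** [tame_by C f]: [f] is continuous on the whole line and dominated by
    [C / (1 + x ^ 2)]. All the integrals below have such integrands. *)
Definition tame_by {R : realType} (C : R) (f : R -> R) :=
  continuous f /\ forall x, `|f x| <= C * (oneDsqr x)^-1.

Definition tame {R : realType} (f : R -> R) := exists C, tame_by C f.

(** The integral over the half-line [x >= 0]. *)
Definition halfint {R : realType} (f : R -> R) : R :=
  \int[@lebesgue_measure R]_(x in `[0, +oo[) f x.

Section HalfLine.
Context {R : realType}.
Implicit Types (f g F : R -> R) (C x : R).

Local Notation mu := (@lebesgue_measure R).

Lemma tame_byW {C f} : tame_by C f -> tame f.
Proof. by exists C. Qed.

Lemma eq_tame {f g} : f =1 g -> tame f -> tame g.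
Proof. by move=> /funext ->. Qed.

Lemma tame_by_ge0 {C f} : tame_by C f -> 0 <= C.
Proof.
move=> [_ /(_ 0)]; rewrite /oneDsqr expr0n addr0 invr1 mulr1.
exact: le_trans.
Qed.

Lemma tame_continuous {f} : tame f -> continuous f.
Proof. by case=> C []. Qed.

Lemma tame_oneDsqrV : tame_by 1 (fun x : R => (oneDsqr x)^-1).
Proof.
split; first exact: continuous_oneDsqrV.
by move=> x; rewrite mul1r ger0_norm// invr_ge0 (le_trans ler01)// oneDsqr_ge1.
Qed.

Lemma tame_byD {C D f g} :
  tame_by C f -> tame_by D g -> tame_by (C + D) (fun x => f x + g x).
Proof.
move=> [cf bf] [cg bg]; split; first by move=> x; apply: cvgD; [exact: cf|exact: cg].
by move=> x; rewrite mulrDl (le_trans (ler_normD _ _))// lerD.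
Qed.

Lemma tame_byZ (a : R) {C f} :
  tame_by C f -> tame_by (`|a| * C) (fun x => a * f x).
Proof.
move=> [cf bf]; split; first by move=> x; apply: cvgMr; exact: cf.
by move=> x; rewrite normrM -mulrA ler_wpM2l.
Qed.

Lemma tameD {f g} : tame f -> tame g -> tame (fun x => f x + g x).
Proof. by move=> [C fC] [D gD]; exists (C + D); exact: tame_byD. Qed.

Lemma tameZ (a : R) {f} : tame f -> tame (fun x => a * f x).
Proof. by move=> [C fC]; exists (`|a| * C); exact: tame_byZ. Qed.

Lemma tameB {f g} : tame f -> tame g -> tame (fun x => f x - g x).
Proof.
by move=> tf tg; apply: eq_tame (tameD tf (tameZ (-1) tg)) => x; rewrite mulN1r.
Qed.

Lemma tame0 : tame (fun _ : R => 0).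
Proof.
by apply: eq_tame (tameZ 0 (tame_byW tame_oneDsqrV)) => x; rewrite mul0r.
Qed.

Lemma tame_sum (I : Type) (s : seq I) (P : pred I) (f : I -> R -> R) :
  (forall i, tame (f i)) -> tame (fun x => \sum_(i <- s | P i) f i x).
Proof.
move=> tf; elim: s => [|i s IH].
  by apply: eq_tame tame0 => x; rewrite big_nil.
case: (boolP (P i)) => Pi; last first.
  by apply: eq_tame IH => x; rewrite big_cons (negbTE Pi).
by apply: eq_tame (tameD (tf i) IH) => x; rewrite big_cons Pi.
Qed.

Lemma tame_reflect {f} : tame f -> tame (fun x => f (- x)).
Proof.
move=> [C [cf bf]]; exists C; split.
  move=> x; apply: (@continuous_comp _ _ _ (fun y : R => - y) f) => //.
    exact: opp_continuous.
  exact: cf.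
by move=> x; rewrite (le_trans (bf _))// /oneDsqr sqrrN.
Qed.

Lemma tame_integrable f : tame f -> mu.-integrable `[0, +oo[ (EFin \o f).
Proof.
move=> [C tf]; have [cf bf] := tf; have C0 := tame_by_ge0 tf.
have dom0 (x : R) : 0 <= (oneDsqr x)^-1 :> R.
  by rewrite invr_ge0 (le_trans ler01)// oneDsqr_ge1.
have mdom : measurable_fun (`[0, +oo[%classic : set R) (EFin \o (fun x : R => (oneDsqr x)^-1)).
  apply/measurable_EFinP; apply: measurable_funTS.
  apply: continuous_measurable_fun.
  exact: (tame_continuous (tame_byW tame_oneDsqrV)).
have dom_int : mu.-integrable `[0, +oo[ (EFin \o (fun x => (oneDsqr x)^-1)).
  apply/integrableP; split.
    exact: mdom.
    apply: (@le_lt_trans _ _ (pi / 2)%:E); last exact: ltry.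
  rewrite -integral0y_oneDsqr.
  apply: ge0_le_integral => //=.
  - apply/measurable_EFinP; apply: measurableT_comp => //.
    exact/measurable_EFinP.
  - by move=> x _; rewrite ger0_norm.
apply: (le_integrable _ _ _ (@integrableZl _ _ _ _ _ _ C _ dom_int)) => //.
  apply/measurable_EFinP; apply: measurable_funTS.
  exact: continuous_measurable_fun.
by move=> x _ /=; rewrite lee_fin (le_trans (bf x))// ger0_norm// mulr_ge0.
Qed.

Lemma eq_halfint f g : f =1 g -> halfint f = halfint g.
Proof. by move=> /funext ->. Qed.

Lemma halfintD {f g} : tame f -> tame g ->
  halfint (fun x => f x + g x) = halfint f + halfint g.
Proof. by move=> /tame_integrable tf /tame_integrable tg; exact: RintegralD. Qed.

Lemma halfintZ (a : R) {f} : tame f ->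
  halfint (fun x => a * f x) = a * halfint f.
Proof. by move=> /tame_integrable tf; exact: RintegralZl. Qed.

Lemma halfintB {f g} : tame f -> tame g ->
  halfint (fun x => f x - g x) = halfint f - halfint g.
Proof. by move=> /tame_integrable tf /tame_integrable tg; exact: RintegralB. Qed.

Lemma halfint0 : halfint (fun _ : R => 0) = 0.
Proof.
by have := halfintZ 0 tame0; rewrite !mul0r.
Qed.

Lemma halfint_sum (I : Type) (s : seq I) (P : pred I) (f : I -> R -> R) :
  (forall i, tame (f i)) ->
  halfint (fun x => \sum_(i <- s | P i) f i x) = \sum_(i <- s | P i) halfint (f i).
Proof.
move=> tf; elim: s => [|i s IH].
  by rewrite big_nil -[RHS]halfint0; apply: eq_halfint => x; rewrite big_nil.
rewrite big_cons; case: ifPn => Pi.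
  rewrite -IH -(halfintD (tf i) (tame_sum _ s P f tf)).
  by apply: eq_halfint => x; rewrite big_cons Pi.
by rewrite -IH; apply: eq_halfint => x; rewrite big_cons (negbTE Pi).
Qed.

Lemma halfint_le {f g} : tame f -> tame g ->
  (forall x, 0 <= x -> f x <= g x) -> halfint f <= halfint g.
Proof.
move=> /tame_integrable tf /tame_integrable tg fg.
by apply: le_Rintegral => // x /=; rewrite in_itv/= andbT; exact: fg.
Qed.

Lemma halfint_ge0 {f} : (forall x, 0 <= x -> 0 <= f x) -> 0 <= halfint f.
Proof.
by move=> f0; apply: Rintegral_ge0 => x /=; rewrite in_itv/= andbT; exact: f0.
Qed.

(** The mass of the dominating function. *)
Definition dommass : R := halfint (fun x => (oneDsqr x)^-1).

Lemma dommass_ge0 : 0 <= dommass.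
Proof.
by apply: halfint_ge0 => x _; rewrite invr_ge0 (le_trans ler01)// oneDsqr_ge1.
Qed.

Lemma halfint_bound {C f} : tame_by C f -> `|halfint f| <= C * dommass.
Proof.
move=> tCf; have [cf bf] := tCf; have tf := tame_byW tCf.
have td := tame_byW tame_oneDsqrV.
rewrite ler_norml; apply/andP; split.
  rewrite -mulNr -halfintZ//; apply: halfint_le => //; first exact: tameZ.
  by move=> x _; have := bf x; rewrite ler_norml mulNr => /andP[].
rewrite -halfintZ//; apply: halfint_le => //; first exact: tameZ.
by move=> x _; have := bf x; rewrite ler_norml => /andP[].
Qed.

Lemma halfint_FTC_nonneg f F l : tame f -> (forall x, 0 <= f x) ->
  (forall x, is_derive x 1 F (f x)) -> F x @[x --> +oo] --> l ->
  halfint f = l - F 0.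
Proof.
move=> tf f0 dF Fl; apply: Rintegral_ge0_continuous_FTC2y => //.
- by apply: continuous_subspaceT; exact: tame_continuous.
- apply: cvg_at_right_filter; apply: differentiable_continuous.
  by apply/derivable1_diffP.
- by move=> x _; rewrite derive1E; have [_] := dF x.
Qed.

Lemma tame_cvg0 f : tame f -> f x @[x --> +oo] --> 0.
Proof.
move=> [C tf]; have [cf bf] := tf; have C0 := tame_by_ge0 tf.
apply/cvgrPdist_le => e e0; near=> x.
have x0 : 1 <= x by near: x; exact: nbhs_pinfty_ge.
have x1 : C / e <= x by near: x; apply: nbhs_pinfty_ge; rewrite num_real.
rewrite sub0r normrN (le_trans (bf x))// ler_pdivrMr; last first.
  by rewrite (lt_le_trans ltr01)// oneDsqr_ge1.
rewrite ler_pdivrMr// in x1; rewrite (le_trans x1)// mulrC ler_pM2l//.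
by rewrite /oneDsqr expr2; nra.
Unshelve. all: by end_near. Qed.

Lemma halfint_FTC {f F} : tame f -> tame F ->
  (forall x, is_derive x 1 F (f x)) -> halfint f = - F 0.
Proof.
move=> tf tF dF; have [C [cf bf]] := tf; have td := tame_byW tame_oneDsqrV.
have dat x : is_derive x 1 (@atan R) ((oneDsqr x)^-1) by exact: is_derive1_atan.
have dompos x : 0 <= (oneDsqr x)^-1 :> R.
  by rewrite invr_ge0 (le_trans ler01)// oneDsqr_ge1.
have Id : halfint (fun x => (oneDsqr x)^-1) = pi / 2 :> R.
  by rewrite (@halfint_FTC_nonneg _ _ (pi / 2) td dompos dat) ?atan0 ?subr0//;
    exact: cvgy_atan.
(* adding a multiple of the dominating function makes the integrand nonnegative *)
have : halfint (fun x => f x + C * (oneDsqr x)^-1) = C * (pi / 2) - F 0.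
  rewrite (@halfint_FTC_nonneg _ (fun x => F x + C * atan x) (C * (pi / 2))).
  - by rewrite atan0 mulr0 addr0.
  - exact/tameD/tameZ.
  - by move=> x; have := bf x; rewrite ler_norml => /andP[]; lra.
  - rewrite -[X in _ --> X]add0r; apply: cvgD; first exact: tame_cvg0.
    by apply: cvgMr; exact: cvgy_atan.
rewrite halfintD//; last exact: tameZ.
by rewrite halfintZ// Id; lra.
Qed.

(** A nonnegative tame function which is positive at one point of the open
    half-line has positive integral. *)
Lemma halfint_gt0 f (a : R) : tame f -> (forall x, 0 <= x -> 0 <= f x) ->
  0 < a -> 0 < f a -> 0 < halfint f.
Proof.
move=> tf f0 a0 fa; have cf := tame_continuous tf.
have fi := tame_integrable _ tf.
have [e /= e0 He] : exists2 e : R, 0 < e & forall x, `|a - x| < e -> f a / 2 < f x.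
  have : \forall x \near a, f a / 2 < f x.
    by apply: (cvgr_gt (f a) (cf a)); lra.
  by move=> /nbhs_ballP[e /= e0 He]; exists e.
pose b := Num.min (e / 2) (a / 2).
have b0 : 0 < b by rewrite lt_min; apply/andP; split; lra.
have be : b <= e / 2 by rewrite ge_min lexx.
have ba : b <= a / 2 by rewrite ge_min lexx orbT.
have sub : `[a, a + b] `<=` `[0, +oo[.
  by move=> x /=; rewrite !in_itv/= andbT => /andP[+ _]; apply: le_trans; lra.
have int_sub : mu.-integrable `[a, a + b] (EFin \o f) by apply: integrableS fi.
have muI : mu `[a, a + b]%classic = b%:E.
  have := @lebesgue_measure_itv R `[a, a + b]; rewrite /= lte_fin ltrDl b0 -EFinB.
  by rewrite addrAC subrr add0r.
suff : \int[mu]_(x in `[a, a + b]) f x <= halfint f.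
  apply: lt_le_trans; apply: (@lt_le_trans _ _ (\int[mu]_(x in `[a, a + b]) (f a / 2))).
    rewrite Rintegral_cst//; apply: mulr_gt0; first by rewrite divr_gt0.
    by rewrite (congr1 fine muI).
  apply: le_Rintegral => //.
    apply/integrableP; split; first exact: measurable_cst.
    by rewrite integral_cst//= (congr1 (fun m => _ * m)%E muI) -EFinM ltry.
  move=> x /=; rewrite in_itv/= => /andP[ax xb]; apply/ltW/He.
  by rewrite ler0_norm; lra.
rewrite /halfint Rintegral_mkcond [leRHS]Rintegral_mkcond.
apply: le_Rintegral => //.
- by rewrite -restrict_EFin; apply/(integrable_mkcond _ _).1.
- by rewrite -restrict_EFin; apply/(integrable_mkcond _ _).1.
- move=> x _; rewrite /patch; case: ifPn => [/set_mem/sub/mem_set ->//|_].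
  case: ifPn => // /set_mem /=; rewrite in_itv/= andbT; exact: f0.
Qed.

End HalfLine.
(** * A smooth bump *)

Section ExpPoly.
Context {R : realType}.
Implicit Types (P : {poly R}) (x y z : R).

Lemma expn_le_fact_expR n y : 0 <= y -> y ^+ n <= n`!%:R * expR y.
Proof.
move=> y0; case: n => [|n]; first by rewrite expr0 fact0 mul1r -expR0 ler_expR.
have F : 0 < (n.+1)`!%:R :> R by rewrite ltr0n fact_gt0.
rewrite mulrC -ler_pdivrMr// (le_trans _ (expR_ge1Dxn n y0))//.
by rewrite lerDr ler01.
Qed.

Lemma poly_expR_bound P : exists2 C : R, 0 <= C & forall y, `|P.[y]| * expR (- `|y|) <= C.
Proof.
exists (\sum_(i < size P) `|P`_i| * i`!%:R).
  by apply: sumr_ge0 => i _; rewrite mulr_ge0.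
move=> y; rewrite expRN ler_pdivrMr ?expR_gt0// horner_coef mulr_suml.
rewrite (le_trans (ler_norm_sum _ _ _))// ler_sum// => i _.
by rewrite normrM normrX -mulrA ler_wpM2l// expn_le_fact_expR.
Qed.

End ExpPoly.

(** [flat P] is the function [P(1/x) exp(-1/x)], extended by zero to the
    nonpositive half-line. *)
Definition flat {R : realType} (P : {poly R}) (x : R) : R :=
  if 0 < x then P.[x^-1] * expR (- x^-1) else 0.

Section Flat.
Context {R : realType}.
Implicit Types (P : {poly R}) (x y z : R).

Lemma flat_le0 P x : x <= 0 -> flat P x = 0.
Proof. by rewrite /flat ltNge => ->. Qed.

Lemma flat_bounded P : exists2 C : R, 0 <= C & forall x, `|flat P x| <= C.
Proof.
have [C C0 HC] := poly_expR_bound P; exists C => // x; rewrite /flat.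
case: ifP => x0; last by rewrite normr0.
have := HC x^-1; rewrite normrM [`|expR _|]ger0_norm ?expR_ge0//.
by rewrite [`|x^-1|]ger0_norm// invr_ge0 ltW.
Qed.

(** Flatness at the origin: this makes [flat P] differentiable there. *)
Lemma flat_quadratic P : exists C : R, forall x, `|flat P x| <= C * x ^+ 2.
Proof.
have [C C0 HC] := flat_bounded ('X ^+ 2 * P); exists C => x.
have [x0|x0] := leP x 0; first by rewrite flat_le0// normr0 mulr_ge0// sqr_ge0.
have x2 : 0 < x ^+ 2 by rewrite exprn_gt0.
have E : flat ('X ^+ 2 * P) x = (x ^+ 2)^-1 * flat P x.
  by rewrite /flat x0 hornerM hornerXn exprVn mulrA.
have := HC x; rewrite E normrM [`|_^-1|]ger0_norm ?invr_ge0 ?(ltW x2)//.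
by rewrite ler_pdivrMl// [leRHS]mulrC.
Qed.

Lemma flat_derive P x : is_derive x 1 (flat P) (flat ('X ^+ 2 * (P - P^`())) x).
Proof.
have [x0|x0|->] := ltgtP x 0.
- rewrite [flat _ x]flat_le0 ?ltW//.
  apply: (@near_eq_is_derive _ _ _ (cst 0)).
    near=> y; rewrite flat_le0//; apply/ltW.
    by near: y; exact: lt_nbhsl.
- have xN : x != 0 by rewrite gt_eqF.
  apply: (@near_eq_is_derive _ _ _ (fun y => P.[y^-1] * expR (- y^-1))).
    near=> y; rewrite /flat ifT//.
    by near: y; exact: lt_nbhsr.
  have Hi : is_derive x 1 (fun y : R => y^-1) (- x ^- 2).
    apply: is_derive_val (is_deriveV _ (is_derive_id x 1)) _ => //.
    by rewrite /GRing.scale/= mulr1.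
  have HN : is_derive x 1 (fun y : R => - y^-1) (x ^- 2).
    apply: is_derive_fun (is_derive_val (is_derive_scalef (-1) Hi) _) => [y|].
      by rewrite mulN1r.
    by rewrite mulN1r opprK.
  have H1 := is_derive1_comp (is_derive_poly P x^-1) Hi.
  have H2 := @is_derive1_comp _ (@expR R) (fun y : R => - y^-1) x _ _ (is_derive_expR (- x^-1)) HN.
  apply: is_derive_val (is_derive_mulf H1 H2) _.
  by rewrite /flat x0 !hornerE /=; field.
- rewrite [flat _ 0]flat_le0//.
  have [C HC] := flat_quadratic P.
  apply: (is_derive_quadratic C) => h _.
  by rewrite [flat P 0]flat_le0// mulr0 !subr0 addr0 /GRing.scale/= mulr1.
Unshelve. all: by end_near. Qed.

End Flat.

(** [smooth_bounded n f]: [f] has [n] derivatives, and is bounded together with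
    them. *)
Fixpoint smooth_bounded {R : realType} (n : nat) (f : R -> R) : Prop :=
  (exists C : R, forall x, `|f x| <= C) /\
  match n with
  | 0 => True
  | m.+1 => exists2 g : R -> R, (forall x : R, is_derive x 1 f (g x)) & smooth_bounded m g
  end.

Section SmoothBounded.
Context {R : realType}.
Implicit Types (f g : R -> R) (P : {poly R}) (n : nat).

Lemma eq_smooth_bounded {n f g} : f =1 g ->
  smooth_bounded n f -> smooth_bounded n g.
Proof. by move=> /funext ->. Qed.

Lemma smooth_boundedW {n f} : smooth_bounded n.+1 f -> smooth_bounded n f.
Proof.
elim: n f => [|n IH] f [bf [g dg sg]]; first by [].
by split => //; exists g => //; exact: IH.
Qed.

Lemma smooth_boundedD {n f g} : smooth_bounded n f -> smooth_bounded n g ->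
  smooth_bounded n (fun x => f x + g x).
Proof.
elim: n f g => [|n IH] f g [[C bf] sf] [[D bg] sg]; (split;
  first by exists (C + D) => x; rewrite (le_trans (ler_normD _ _))// lerD) => //.
move: sf sg => [f' df sf] [g' dg sg]; exists (fun x => f' x + g' x); last exact: IH.
by move=> x; exact: is_derive_addf.
Qed.

Lemma smooth_boundedM {n f g} : smooth_bounded n f -> smooth_bounded n g ->
  smooth_bounded n (fun x => f x * g x).
Proof.
elim: n f g => [|n IH] f g sf sg; have [[C bf] sf'] := sf; have [[D bg] sg'] := sg;
  (split; first by exists (C * D) => x; rewrite normrM ler_pM) => //.
move: sf' sg' => [f' df sf'] [g' dg sg'].
exists (fun x => f' x * g x + f x * g' x).
  by move=> x; exact: is_derive_mulf.
by apply: smooth_boundedD; apply: IH => //; exact: smooth_boundedW.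
Qed.

Lemma smooth_bounded_affine (a b : R) {n f} : smooth_bounded n f ->
  smooth_bounded n (fun x => f (a * x + b)).
Proof.
elim: n f => [|n IH] f [[C bf] sf]; (split; first by exists C) => //.
move: sf => [f' df sf]; exists (fun x => a * f' (a * x + b)).
  by move=> x; exact: is_derive_affine.
have := IH _ sf; apply: smooth_boundedM.
elim: (n) (a) => [|m IHm] c; (split; first by exists `|c|) => //.
by exists (fun=> 0) => // x; exact: is_derive_cst.
Qed.

Lemma smooth_bounded_flat n P : smooth_bounded n (flat P).
Proof.
elim: n P => [|n IH] P; have [C _ bC] := flat_bounded P; (split; first by exists C) => //.
by exists (flat ('X ^+ 2 * (P - P^`()))) => // x; exact: flat_derive.
Qed.

Lemma smooth_bounded_derive1n {f} : (forall n, smooth_bounded n f) ->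
  forall n (x : R), is_derive x 1 f^`(n)%classic (f^`(n.+1)%classic x).
Proof.
move=> sf n; have : smooth_bounded n.+1 f by [].
move=> {sf}; elim: n f => [|n IH] f [_ [g dg sg]] x.
  by rewrite derive1n1 derive1n0 derive1E; have [_ ->] := dg x; exact: dg.
have fg : f^`()%classic = g by apply/funext => y; rewrite derive1E; have [] := dg y.
by rewrite !derive1Sn fg -derive1Sn; exact: IH.
Qed.

Lemma smooth_bounded_derive1n_bounded {f} : (forall n, smooth_bounded n f) ->
  forall n, exists C : R, forall x, `|f^`(n)%classic x| <= C.
Proof.
move=> sf n; have : smooth_bounded n f by [].
move=> {sf}; elim: n f => [|n IH] f [bf sf]; first by rewrite derive1n0.
have [g dg sg] := sf; rewrite derive1Sn.
have -> : f^`()%classic = g by apply/funext => y; rewrite derive1E; have [] := dg y.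
exact: IH.
Qed.

End SmoothBounded.

(** The derivatives of a smooth bump supported in [[1, 2]]. *)
Definition bump {R : realType} (n : nat) : R -> R :=
  (fun x : R => flat 1 (x - 1) * flat 1 (2 - x))^`(n)%classic.

Section Bump.
Context {R : realType}.
Implicit Types (x : R) (n : nat).

Lemma bumpE x : bump 0 x = flat 1 (x - 1) * flat 1 (2 - x).
Proof. by rewrite /bump derive1n0. Qed.

Lemma smooth_bounded_bump n :
  smooth_bounded n (fun x : R => flat 1 (x - 1) * flat 1 (2 - x)).
Proof.
apply: smooth_boundedM.
  apply: eq_smooth_bounded (smooth_bounded_affine 1 (-1) (smooth_bounded_flat n 1)).
  by move=> x; rewrite mul1r.
apply: eq_smooth_bounded (smooth_bounded_affine (-1) 2 (smooth_bounded_flat n 1)).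
by move=> x; rewrite mulN1r addrC.
Qed.

Lemma bump_derive n x : is_derive x 1 (bump n) (bump n.+1 x).
Proof. exact: smooth_bounded_derive1n smooth_bounded_bump n x. Qed.

Lemma bump_bounded n : exists C : R, forall x, `|bump n x| <= C.
Proof. exact: smooth_bounded_derive1n_bounded smooth_bounded_bump n. Qed.

Lemma bump_ge0 x : 0 <= bump 0 x.
Proof.
rewrite bumpE mulr_ge0// /flat; case: ifP => // _;
  by rewrite hornerE mul1r expR_ge0.
Qed.

Lemma bump_gt0 : 0 < bump 0 (3 / 2 : R).
Proof.
have e1 : (3 / 2 - 1 : R) = 1 / 2 by field.
have e2 : (2 - 3 / 2 : R) = 1 / 2 by field.
by rewrite bumpE e1 e2 /flat divr_gt0//= mulr_gt0// hornerE mul1r expR_gt0.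
Qed.

Lemma bump_out n x : (x < 1) || (2 < x) -> bump n x = 0.
Proof.
elim: n x => [|n IH] x out.
  rewrite bumpE; case/orP: out => out.
    by rewrite flat_le0 ?mul0r//; lra.
  by rewrite [X in _ * X]flat_le0 ?mulr0//; lra.
have [_ <-] := bump_derive n x.
rewrite (@near_eq_derive _ _ _ _ (cst 0)) ?derive_cst//.
case/orP: out => out; near=> y; rewrite IH//.
  by apply/orP; left; near: y; exact: lt_nbhsl.
by apply/orP; right; near: y; exact: lt_nbhsr.
Unshelve. all: by end_near. Qed.

Lemma bump_supp n x : bump n x != 0 -> 1 <= x <= 2.
Proof.
by apply: contraNT; rewrite negb_and -!ltNge => /bump_out ->.
Qed.

End Bump.
(** * Gaussian weights *)

(** A polynomial times the Gaussian [exp (- 3/4 z ^ 2)]. The Gaussian is not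
    normalised; its variance [2 / 3] is the one which makes [heat] below solve
    [d/dr = 2 r ^ 5 (d/dy) ^ 2]. *)
Definition gpoly {R : realType} (P : {poly R}) (z : R) : R :=
  P.[z] * expR (- (3 / 4 * z ^+ 2)).

(** The operator [P |-> Q] for which [gpoly Q] is minus the derivative of
    [gpoly P]. *)
Definition gderiv {R : realType} (P : {poly R}) : {poly R} :=
  (3 / 2) *: ('X * P) - P^`().

(** The integral over the whole line, folded at the origin. *)
Definition lineint {R : realType} (f : R -> R) : R :=
  halfint (fun z => f z + f (- z)).

Section Gauss.
Context {R : realType}.
Implicit Types (P : {poly R}) (x y z : R) (f g F : R -> R).

Lemma gpoly_derive P z : is_derive z 1 (gpoly P) (- gpoly (gderiv P) z).
Proof.
have H : is_derive z 1 (fun z : R => - (3 / 4 * z ^+ 2)) (- (3 / 2 * z)).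
  have Hs := is_derive_mulf (is_derive_id z (1 : R)) (is_derive_id z (1 : R)).
  apply: is_derive_fun (is_derive_val (is_derive_scalef (- (3 / 4)) Hs) _).
    by move=> y; rewrite mulNr expr2.
  by rewrite /=; field.
have H2 := @is_derive1_comp _ (@expR R) _ z _ _ (is_derive_expR _) H.
apply: is_derive_val (is_derive_mulf (is_derive_poly P z) H2) _.
by rewrite /gpoly /gderiv hornerD hornerN hornerZ hornerM hornerX /=; field.
Qed.

Lemma gpoly_continuous P : continuous (gpoly P).
Proof. exact: is_derive_continuous (gpoly_derive P). Qed.

Lemma gpoly_tame P : exists C, tame_by C (gpoly P).
Proof.
have [C C0 HC] := poly_expR_bound ((1 + 'X ^+ 2) * P).
exists (C * expR (1 / 3)); split; first exact: gpoly_continuous.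
move=> z; have d0 : 0 < oneDsqr z by rewrite (lt_le_trans ltr01)// oneDsqr_ge1.
rewrite ler_pdivlMr// /gpoly normrM [`|expR _|]ger0_norm ?expR_ge0//.
have E : `|((1 + 'X ^+ 2) * P).[z]| = oneDsqr z * `|P.[z]|.
  rewrite hornerM hornerD hornerC hornerXn normrM ger0_norm//.
  by rewrite (le_trans ler01)// oneDsqr_ge1.
have := HC z; rewrite E => H.
(* the exponents differ by a square *)
have e : expR (- (3 / 4 * z ^+ 2)) <= expR (- `|z|) * expR (1 / 3).
  rewrite -expRD ler_expR -[z ^+ 2]real_normK ?num_real//.
  by rewrite -subr_ge0 [leRHS](_ : _ = 3 / 4 * (`|z| - 2 / 3) ^+ 2);
    [rewrite mulr_ge0 ?sqr_ge0//; lra|field].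
rewrite (le_trans (ler_wpM2r (ltW d0) (ler_wpM2l (normr_ge0 _) e)))//.
rewrite [leLHS](_ : _ = oneDsqr z * `|P.[z]| * expR (- `|z|) * expR (1 / 3)); last by ring.
by rewrite ler_wpM2r ?expR_ge0.
Qed.

Lemma tame_fold {f} : tame f -> tame (fun z => f z + f (- z)).
Proof. by move=> tf; exact: tameD (tame_reflect tf). Qed.

Lemma eq_lineint f g : f =1 g -> lineint f = lineint g.
Proof. by move=> /funext ->. Qed.

Lemma lineintD {f g} : tame f -> tame g ->
  lineint (fun x => f x + g x) = lineint f + lineint g.
Proof.
move=> tf tg; rewrite /lineint -halfintD; [|exact: tame_fold..].
by apply: eq_halfint => z; ring.
Qed.

Lemma lineintZ (a : R) {f} : tame f ->
  lineint (fun x => a * f x) = a * lineint f.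
Proof.
move=> tf; rewrite /lineint -halfintZ; last exact: tame_fold.
by apply: eq_halfint => z; ring.
Qed.

Lemma lineintB {f g} : tame f -> tame g ->
  lineint (fun x => f x - g x) = lineint f - lineint g.
Proof.
move=> tf tg; rewrite /lineint -halfintB; [|exact: tame_fold..].
by apply: eq_halfint => z; ring.
Qed.

Lemma lineint_bound {C f} : tame_by C f -> `|lineint f| <= C * (2 * dommass).
Proof.
move=> tf; have [cf bf] := tf.
have tr : tame_by C (fun z => f (- z)).
  split; first by apply: tame_continuous; apply: tame_reflect; exists C.
  by move=> x; rewrite (le_trans (bf _))// /oneDsqr sqrrN.
have := halfint_bound (tame_byD tf tr).
by rewrite mulrDl -mulr2n -mulrnAr mulr_natl.
Qed.

Lemma lineint_ge0 {f} : (forall x, 0 <= f x) -> 0 <= lineint f.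
Proof. by move=> f0; apply: halfint_ge0 => x _; rewrite addr_ge0. Qed.

Lemma lineint_gt0 {f} a : tame f -> (forall x, 0 <= f x) -> 0 < a -> 0 < f a ->
  0 < lineint f.
Proof.
move=> tf f0 a0 fa; apply: (@halfint_gt0 _ _ a) => //.
- exact: tame_fold.
- by move=> x _; rewrite addr_ge0.
- by rewrite ltr_wpDr.
Qed.

Lemma lineint_FTC {f F} : tame f -> tame F ->
  (forall x, is_derive x 1 F (f x)) -> lineint f = 0.
Proof.
move=> tf tF dF; rewrite /lineint.
have dFf x : is_derive x 1 (fun z => F z - F (- z)) (f x + f (- x)).
  have H : is_derive x 1 (fun z => F (- z)) (- f (- x)).
    have Hx : is_derive (-1 * x + 0) 1 F (f (- x)).
      by rewrite mulN1r addr0; exact: dF.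
    apply: is_derive_fun (is_derive_val (is_derive_affine _ _ Hx) _).
      by move=> z; rewrite mulN1r addr0.
    by rewrite mulN1r.
  apply: is_derive_fun (is_derive_val (is_derive_addf (dF x) (is_derive_scalef (-1) H)) _).
    by move=> z; rewrite mulN1r.
  by rewrite mulN1r opprK.
rewrite (halfint_FTC (tame_fold tf) (tameB tF (tame_reflect tF)) dFf).
by rewrite oppr0 subrr oppr0.
Qed.

End Gauss.

(** * Heat evolution of the bump *)

(** The average of the [n]-th derivative of the bump against the Gaussian
    weight [P(z) exp (- 3/4 z ^ 2)], at scale [rho] around [y]. *)
Definition avg {R : realType} (n : nat) (P : {poly R}) (rho y : R) : R :=
  lineint (fun z => bump n (y + rho * z) * gpoly P z).

Section Avg.
Context {R : realType}.
Implicit Types (P Q : {poly R}) (x y z rho : R) (n : nat).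

Lemma tame_by_mul {C M : R} {f g : R -> R} : continuous f ->
  (forall x, `|f x| <= M) -> tame_by C g -> tame_by (M * C) (fun x => f x * g x).
Proof.
move=> cf bf [cg bg]; split; first by move=> x; apply: cvgM; [exact: cf|exact: cg].
by move=> x; rewrite normrM -mulrA ler_pM.
Qed.

Lemma avg_tame n P : exists K : R, forall rho y,
  tame_by K (fun z => bump n (y + rho * z) * gpoly P z).
Proof.
have [M HM] := @bump_bounded R n; have [C tP] := gpoly_tame P.
exists (M * C) => rho y; apply: tame_by_mul => // x.
have /is_derive_continuous cb : forall x : R, is_derive x 1
    (fun z => bump n (rho * z + y)) (rho * bump n.+1 (rho * x + y)).
  by move=> z; apply: is_derive_affine; exact: bump_derive.
by rewrite (_ : (fun z => _) = (fun z => bump n (rho * z + y)));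
  [exact: cb|apply/funext => z; rewrite addrC].
Qed.

Lemma avg_integrand_tame n P rho y :
  tame (fun z => bump n (y + rho * z) * gpoly P z).
Proof. by have [K tK] := avg_tame n P; exists K. Qed.

Lemma avg_bound n P : exists K : R, forall rho y, `|avg n P rho y| <= K.
Proof.
have [K tK] := avg_tame n P; exists (K * (2 * dommass)) => rho y.
exact: lineint_bound (tK rho y).
Qed.

Lemma avg_scale n (a : R) P rho y : avg n (a *: P) rho y = a * avg n P rho y.
Proof.
rewrite -lineintZ; last exact: avg_integrand_tame.
by apply: eq_lineint => z; rewrite /gpoly hornerZ; ring.
Qed.

(** Integration by parts. *)
Lemma avg_ibp n P rho y : rho * avg n.+1 P rho y = avg n (gderiv P) rho y.
Proof.
apply/eqP; rewrite -subr_eq0; apply/eqP.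
have t1 := avg_integrand_tame n.+1 P rho y.
have t2 := avg_integrand_tame n (gderiv P) rho y.
rewrite -lineintZ// -lineintB//; last exact: tameZ.
apply: (lineint_FTC _ (avg_integrand_tame n P rho y)).
  by apply: tameB => //; exact: tameZ.
move=> z; have Hz : is_derive (rho * z + y) 1 (bump n) (bump n.+1 (rho * z + y)).
  exact: bump_derive.
apply: is_derive_fun (is_derive_val (is_derive_mulf (is_derive_affine _ _ Hz) (gpoly_derive P z)) _).
  by move=> w; rewrite addrC.
by rewrite [rho * z + y]addrC /=; ring.
Qed.

(** Integrating by parts [n] times trades the derivatives of the bump for powers
    of [1 / rho]. *)
Lemma avg_decay n P : exists K : R, forall rho y, `|rho| ^+ n * `|avg n P rho y| <= K.
Proof.
have [K HK] := avg_bound 0 (iter n gderiv P); exists K => rho y.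
rewrite (le_trans _ (HK rho y))// le_eqVlt; apply/orP; left; apply/eqP.
elim: n P {HK} => [|n IH] P; first by rewrite expr0 mul1r.
by rewrite exprSr -mulrA -normrM avg_ibp IH iterSr.
Qed.

Lemma avg_quadratic n P : exists K : R, forall rho y s h,
  `|avg n P (rho + s) (y + h) - avg n P rho y -
    (h * avg n.+1 P rho y + s * avg n.+1 ('X * P) rho y)| <= K * (s ^+ 2 + h ^+ 2).
Proof.
have [M HM] := @bump_bounded R n.+2.
have [C1 tP1] := gpoly_tame P.
have [C2 tP2] := gpoly_tame ('X ^+ 2 * P).
have M0 : 0 <= M := le_trans (normr_ge0 _) (HM 0).
have C10 := tame_by_ge0 tP1; have C20 := tame_by_ge0 tP2.
pose A : R := 2 * dommass; have A0 : 0 <= A by rewrite mulr_ge0// dommass_ge0.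
exists (2 * M * (C1 + C2) * A) => rho y s h.
have t := avg_integrand_tame.
pose f1 z := bump n (y + h + (rho + s) * z) * gpoly P z.
pose f2 z := bump n (y + rho * z) * gpoly P z.
pose f3 z := bump n.+1 (y + rho * z) * gpoly P z.
pose f4 z := bump n.+1 (y + rho * z) * gpoly ('X * P) z.
have -> : avg n P (rho + s) (y + h) - avg n P rho y -
    (h * avg n.+1 P rho y + s * avg n.+1 ('X * P) rho y) =
    lineint (fun z => f1 z - f2 z - (h * f3 z + s * f4 z)).
  rewrite lineintB; [|by apply: tameB; exact: t|by apply: tameD; apply: tameZ; exact: t].
  rewrite lineintB; [|exact: t..].
  rewrite lineintD; [|by apply: tameZ; exact: t..].
  by rewrite !lineintZ; [|exact: t..].
suff tb : tame_by (2 * M * (C1 * h ^+ 2 + C2 * s ^+ 2))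
    (fun z => f1 z - f2 z - (h * f3 z + s * f4 z)).
  rewrite (le_trans (lineint_bound tb))// -/A [leRHS]mulrAC ler_wpM2r//.
  rewrite -!mulrA ler_wpM2l// ler_wpM2l//.
  have := mulr_ge0 C10 (sqr_ge0 s); have := mulr_ge0 C20 (sqr_ge0 h); lra.
split.
  apply: tame_continuous; apply: tameB; first by apply: tameB; exact: t.
  by apply: tameD; apply: tameZ; exact: t.
move=> z; have d0 : 0 <= (oneDsqr z)^-1.
  by rewrite invr_ge0 (le_trans ler01)// oneDsqr_ge1.
have T := taylor2 M (bump_derive n) (bump_derive n.+1) HM (y + rho * z) (h + s * z).
have -> : f1 z - f2 z - (h * f3 z + s * f4 z) =
  (bump n (y + rho * z + (h + s * z)) - bump n (y + rho * z) -
   (h + s * z) * bump n.+1 (y + rho * z)) * gpoly P z.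
  rewrite /f1 /f2 /f3 /f4 /gpoly hornerM hornerX.
  rewrite (_ : y + h + (rho + s) * z = y + rho * z + (h + s * z)); first by ring.
  by ring.
rewrite normrM (le_trans (ler_wpM2r (normr_ge0 _) T))//.
have b1 := tP1.2 z; have b2 := tP2.2 z.
have b3 : z ^+ 2 * `|gpoly P z| <= C2 / oneDsqr z.
  rewrite (le_trans _ b2)// (_ : gpoly ('X ^+ 2 * P) z = z ^+ 2 * gpoly P z).
    by rewrite [leRHS]normrM [`|z ^+ 2|]ger0_norm ?sqr_ge0.
  by rewrite /gpoly hornerM hornerXn; ring.
have q : (h + s * z) ^+ 2 <= 2 * (h ^+ 2 + s ^+ 2 * z ^+ 2).
  by rewrite -subr_ge0 [leRHS](_ : _ = (h - s * z) ^+ 2); [exact: sqr_ge0|ring].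
apply: (@le_trans _ _ (M * (2 * (h ^+ 2 + s ^+ 2 * z ^+ 2)) * `|gpoly P z|)).
  by rewrite ler_wpM2r// ler_wpM2l.
have -> : M * (2 * (h ^+ 2 + s ^+ 2 * z ^+ 2)) * `|gpoly P z| =
  2 * M * (h ^+ 2 * `|gpoly P z| + s ^+ 2 * (z ^+ 2 * `|gpoly P z|)) by ring.
rewrite -[leRHS]mulrA ler_wpM2l ?mulr_ge0//.
rewrite (le_trans (lerD (ler_wpM2l (sqr_ge0 h) b1) (ler_wpM2l (sqr_ge0 s) b3)))//.
by rewrite le_eqVlt; apply/orP; left; apply/eqP; ring.
Qed.

(** Multiplying the weight by [z] amounts to one more derivative. *)
Lemma avgX n rho y : avg n.+1 ('X * 1) rho y = 2 / 3 * rho * avg n.+2 1 rho y.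
Proof.
have E : 'X * 1 = (2 / 3) *: gderiv (1 : {poly R}).
  have D1 : (1 : {poly R})^`() = 0 by exact: derivC.
  have c : 2 / 3 * (3 / 2) = 1 :> R by field.
  by rewrite /gderiv D1 subr0 scalerA c scale1r.
by rewrite E avg_scale -avg_ibp mulrA.
Qed.

End Avg.
(** [heat n r] is the [n]-th derivative of the bump, evolved by the heat
    equation up to time [r ^ 6 / 3], times a constant. The parameter [r] is a
    square root of the kinetic time: all the dependence on it is then smooth,
    up to [r = 0]. *)
Definition heat {R : realType} (n : nat) (r y : R) : R := avg n 1 (r ^+ 3) y.

Section Heat.
Context {R : realType}.
Implicit Types (r x v y : R) (n : nat).

Lemma heat_derive n r y : is_derive y 1 (heat n r) (heat n.+1 r y).
Proof.
have [K HK] := @avg_quadratic R n 1; apply: (is_derive_quadratic K) => h _.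
have := HK (r ^+ 3) y 0 h; rewrite addr0 mul0r addr0 expr0n add0r.
by rewrite /GRing.scale/= mulr1 [y + h]addrC.
Qed.

(** Each derivative gains one power of [1 + r ^ 2]. *)
Lemma heat_bound n :
  exists2 C : R, 0 <= C & forall r y, (1 + r ^+ 2) ^+ n * `|heat n r y| <= C.
Proof.
have [K HK] := @avg_bound R n 1; have [L HL] := @avg_decay R n 1.
have K0 : 0 <= K := le_trans (normr_ge0 _) (HK 0 0).
have L0 : 0 <= L.
  by apply: le_trans (HL 0 0); rewrite mulr_ge0 ?exprn_ge0.
exists (2 ^+ n * (K + L)); first by rewrite mulr_ge0 ?exprn_ge0 ?addr_ge0.
move=> r y; have r20 := sqr_ge0 r.
have [r1|r1] := lerP `|r| 1.
  rewrite ler_pM ?exprn_ge0 ?addr_ge0//.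
    rewrite lerXn2r ?nnegrE ?addr_ge0// -[r ^+ 2]real_normK ?num_real//.
    by have := normr_ge0 r; nra.
  by rewrite (le_trans (HK _ _))// lerDl.
apply: (@le_trans _ _ (2 ^+ n * (`|r ^+ 3| ^+ n * `|heat n r y|))).
  rewrite mulrA ler_wpM2r// -exprMn lerXn2r// ?nnegrE ?addr_ge0//.
  rewrite normrX -[r ^+ 2]real_normK ?num_real//.
  by nra.
by rewrite ler_wpM2l ?exprn_ge0// (le_trans (HL _ _))// lerDr.
Qed.

(** The evolution along the trajectory [x - r ^ 2 v] of free transport. *)
Lemma heat_flow n x v r :
  is_derive r 1 (fun r => heat n r (x - r ^+ 2 * v))
    (2 * r ^+ 5 * heat n.+2 r (x - r ^+ 2 * v) -
     2 * r * v * heat n.+1 r (x - r ^+ 2 * v)).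
Proof.
have [K HK] := @avg_quadratic R n 1.
set y := x - r ^+ 2 * v.
pose S : R := (3 * r ^+ 2 + 3 * `|r| + 1) ^+ 2 + (`|v| * (2 * `|r| + 1)) ^+ 2.
pose T : R := `|v| * `|heat n.+1 r y| +
  (3 * `|r| + 1) * `|2 / 3 * r ^+ 3 * heat n.+2 r y|.
have K0 : 0 <= K.
  have -> : K = K * (1 ^+ 2 + 0 ^+ 2) by ring.
  exact: le_trans (HK 0 0 1 0).
apply: (is_derive_quadratic (K * S + T)) => h h1.
rewrite /GRing.scale/= mulr1 [h + r]addrC -/y.
(* the increments of [r ^ 3] and of [x - r ^ 2 v] *)
pose s := (r + h) ^+ 3 - r ^+ 3; pose e := - (h * (2 * r + h) * v).
have := HK (r ^+ 3) y s e; rewrite avgX -!/(heat _ _ _).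
have -> : r ^+ 3 + s = (r + h) ^+ 3 by rewrite /s; ring.
have -> : y + e = x - (r + h) ^+ 2 * v by rewrite /y /e; ring.
rewrite -/(heat _ _ _) => Q.
have nr := normr_ge0 r; have nv := normr_ge0 v; have nh := normr_ge0 h.
have h2 : `|h| ^+ 2 = h ^+ 2 by rewrite real_normK ?num_real.
have r2 : `|r| ^+ 2 = r ^+ 2 by rewrite real_normK ?num_real.
have hh : `|h| * `|h| <= `|h| by rewrite ler_piMr.
have sql (a b : R) : `|a| <= b -> a ^+ 2 <= b ^+ 2.
  move=> ab; rewrite -[a ^+ 2]real_normK ?num_real// lerXn2r// nnegrE.
  exact: le_trans ab.
have bs : s ^+ 2 <= (3 * r ^+ 2 + 3 * `|r| + 1) ^+ 2 * h ^+ 2.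
  rewrite -h2 -exprMn sql//.
  rewrite (_ : s = (3 * r ^+ 2 + 3 * r * h + h ^+ 2) * h); last by rewrite /s; ring.
  rewrite normrM ler_wpM2r// (le_trans (ler_normD _ _))// lerD//; last first.
    by rewrite normrX h2 -h2 expr2 (le_trans hh).
  rewrite (le_trans (ler_normD _ _))// lerD//.
    by rewrite ger0_norm// mulr_ge0// sqr_ge0.
  by rewrite !normrM [`|3|]ger0_norm// ler_piMr// mulr_ge0.
have be : e ^+ 2 <= (`|v| * (2 * `|r| + 1)) ^+ 2 * h ^+ 2.
  rewrite -h2 -exprMn sql//.
  rewrite /e normrN !normrM.
  rewrite (_ : _ * `|h| = `|h| * (2 * `|r| + 1) * `|v|); last by ring.
  rewrite ler_wpM2r// ler_wpM2l// (le_trans (ler_normD _ _))// lerD//.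
  by rewrite normrM ger0_norm.
have -> : heat n (r + h) (x - (r + h) ^+ 2 * v) - heat n r y -
    h * (2 * r ^+ 5 * heat n.+2 r y - 2 * r * v * heat n.+1 r y) =
  (heat n (r + h) (x - (r + h) ^+ 2 * v) - heat n r y -
    (e * heat n.+1 r y + s * (2 / 3 * r ^+ 3 * heat n.+2 r y))) +
  (- (v * heat n.+1 r y) + (3 * r + h) * (2 / 3 * r ^+ 3 * heat n.+2 r y)) * h ^+ 2.
  move: (heat n (r + h) _) (heat n r y) (heat n.+1 r y) (heat n.+2 r y).
  by move=> a b c d; rewrite /e /s; field.
rewrite (le_trans (ler_normD _ _))// [leRHS]mulrDl lerD//.
  by rewrite (le_trans Q)// -mulrA ler_wpM2l// /S [leRHS]mulrDl lerD.
rewrite normrM [`|h ^+ 2|]ger0_norm ?sqr_ge0// ler_wpM2r ?sqr_ge0//.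
rewrite (le_trans (ler_normD _ _))// /T lerD//; first by rewrite normrN normrM.
rewrite normrM ler_wpM2r// (le_trans (ler_normD _ _))// lerD//.
by rewrite normrM ger0_norm.
Qed.

(** The mass of the Gaussian; only its independence of [n] and [y] in [heat0]
    matters, not its value. *)
Definition heatmass : R := lineint (gpoly 1).

Lemma heat0 n y : heat n 0 y = heatmass * bump n y.
Proof.
rewrite /heat /avg /heatmass mulrC -lineintZ; last first.
  by have [C tC] := @gpoly_tame R 1; exists C.
by apply: eq_lineint => z; rewrite expr0n mul0r addr0.
Qed.

Lemma bump0_pos (rho z : R) : 0 < rho -> bump 0 (0 + rho * z) != 0 -> 0 < z.
Proof.
move=> rho0 /bump_supp/andP[b1 _].
by rewrite -(pmulr_rgt0 _ rho0); apply: lt_le_trans ltr01 _; rewrite add0r in b1.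
Qed.

(** The average of the derivative of the bump becomes one of the bump itself,
    with the weight [z], which is positive on its support. *)
Lemma avg1E (rho y : R) : rho * avg 1 1 rho y = 3 / 2 * avg 0 'X rho y.
Proof.
rewrite avg_ibp -avg_scale; congr (avg 0 _ rho y).
have D1 : (1 : {poly R})^`() = 0 by exact: derivC.
by rewrite /gderiv D1 subr0 mulr1.
Qed.

Lemma avg0X_ge0 (rho : R) : 0 < rho -> 0 <= avg 0 'X rho 0.
Proof.
move=> rho0; apply: lineint_ge0 => z.
have [->|b0] := eqVneq (bump 0 (0 + rho * z)) 0; first by rewrite mul0r.
have z0 := bump0_pos _ _ rho0 b0.
by rewrite mulr_ge0 ?bump_ge0// /gpoly hornerX mulr_ge0 ?expR_ge0// ltW.
Qed.

Lemma heat1_ge0 r : 0 <= r -> 0 <= heat 1 r 0.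
Proof.
rewrite le_eqVlt => /predU1P[<-|r0].
  by rewrite heat0 bump_out ?mulr0// ltr01.
have r3 : 0 < r ^+ 3 by rewrite exprn_gt0.
by rewrite -(pmulr_rge0 _ r3) avg1E mulr_ge0// avg0X_ge0.
Qed.

Lemma heat1_gt0 : 0 < heat 1 1 (0 : R).
Proof.
have := avg1E 1 0; rewrite mul1r /heat expr1n => ->; rewrite mulr_gt0//.
apply: (lineint_gt0 (3 / 2) (avg_integrand_tame 0 'X 1 0)).
- move=> z; have [->|b0] := eqVneq (bump 0 (0 + 1 * z)) 0; first by rewrite mul0r.
  have z0 := bump0_pos _ _ ltr01 b0.
  by rewrite mulr_ge0 ?bump_ge0// /gpoly hornerX mulr_ge0 ?expR_ge0// ltW.
- by rewrite divr_gt0.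
- by rewrite mul1r add0r mulr_gt0 ?bump_gt0// /gpoly hornerX mulr_gt0 ?expR_gt0.
Qed.

(** The weight is [9/4 z ^ 2 - 3/2], which is positive on the support of the
    bump. *)
Lemma heat2_gt0 : 0 < heat 2 1 (0 : R).
Proof.
have E : heat 2 1 (0 : R) = avg 0 (gderiv (gderiv 1)) 1 0.
  by rewrite -avg_ibp -avg_ibp !mul1r /heat expr1n.
have W z : (gderiv (gderiv (1 : {poly R}))).[z] = 9 / 4 * z ^+ 2 - 3 / 2.
  have D1 : (1 : {poly R})^`() = 0 by exact: derivC.
  rewrite /gderiv D1 subr0 mulr1 derivZ derivX.
  by rewrite hornerD hornerN !hornerZ hornerM hornerZ hornerX hornerC; field.
have Wpos z : 1 <= z -> 0 < (gderiv (gderiv (1 : {poly R}))).[z].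
  by move=> z1; rewrite W; nra.
rewrite E; apply: (lineint_gt0 (3 / 2) (avg_integrand_tame 0 _ 1 0)).
- move=> z; have [->|b0] := eqVneq (bump 0 (0 + 1 * z)) 0; first by rewrite mul0r.
  have := bump_supp _ _ b0; rewrite mul1r add0r => /andP[z1 _].
  by rewrite mulr_ge0 ?bump_ge0// /gpoly mulr_ge0 ?expR_ge0// ltW// Wpos.
- by rewrite divr_gt0.
- rewrite mul1r add0r mulr_gt0 ?bump_gt0// /gpoly mulr_gt0 ?expR_gt0// Wpos//.
  by lra.
Qed.

End Heat.
(** * Smoothness from quadratic estimates *)

Lemma differentiable_quadratic {R : realType} {V : normedModType R}
    {f : V -> R} {p : V} (L : {linear V -> R}) (K C : R) :
  (forall u, `|L u| <= K * `|u|) ->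
  (forall u, `|f (u + p) - f p - L u| <= C * `|u| ^+ 2) -> differentiable f p.
Proof.
move=> HK HC.
have cL : continuous L.
  apply: bounded_linear_continuous; apply/linear_boundedP.
  exists K; split; first exact: num_real.
  by move=> M /ltW KM u; rewrite (le_trans (HK u))// ler_wpM2r.
have E : f \o shift p = cst (f p) + L +o_ 0 id.
  apply/eqaddoP => e e0; near=> u.
  have -> : (f \o shift p - (cst (f p) + L)) u = f (u + p) - f p - L u.
    by rewrite opprD addrA.
  rewrite (le_trans (HC u))// expr2 mulrA ler_wpM2r//.
  have : `|u| <= e / (`|C| + 1).
    near: u; apply: nbhs0_le; rewrite divr_gt0// ltr_wpDl//.
  rewrite ler_pdivlMr ?ltr_wpDl// => H.
  rewrite (le_trans _ H)// mulrC ler_wpM2l// (le_trans (ler_norm _))// lerDl ler01//.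
apply/diff_locallyP; rewrite (diff_unique cL E); split => //.
Unshelve. all: by end_near. Qed.

Section Coordinates.
Context {R : realType} {d : nat}.
Implicit Types (x : 'rV[R]_d) (u p : 'rV[R]_d * 'rV[R]_d).

Lemma coord_le_norm x i : `|x 0 i| <= `|x|.
Proof.
by rewrite [leRHS]/Num.norm/= mx_normrE; apply/bigmax_geP; right; exists (0, i).
Qed.

Lemma fst_le_norm u i : `|u.1 0 i| <= `|u|.
Proof. by rewrite (le_trans (coord_le_norm _ _))// prod_normE le_max lexx. Qed.

Lemma snd_le_norm u i : `|u.2 0 i| <= `|u|.
Proof. by rewrite (le_trans (coord_le_norm _ _))// prod_normE le_max lexx orbT. Qed.

(** The linear form with coefficients [a] and [- b] on the two factors. *)
Definition pairing (a b : 'I_d -> R) u : R :=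
  \sum_i (u.1 0 i * a i - u.2 0 i * b i).

Lemma pairing_is_linear a b : linear (pairing a b).
Proof.
move=> c u w; rewrite /pairing scaler_sumr -big_split /=; apply: eq_bigr => i _.
by rewrite /GRing.scale/= !mxE; ring.
Qed.

HB.instance Definition _ a b := GRing.isLinear.Build R _ R _ (pairing a b)
  (pairing_is_linear a b).

Lemma pairing_bound a b u :
  `|pairing a b u| <= (\sum_i (`|a i| + `|b i|)) * `|u|.
Proof.
rewrite mulr_suml (le_trans (ler_norm_sum _ _ _))// ler_sum// => i _.
rewrite (le_trans (ler_normB _ _))// !normrM mulrDl lerD//.
  by rewrite mulrC ler_wpM2l// fst_le_norm.
by rewrite mulrC ler_wpM2l// snd_le_norm.
Qed.

End Coordinates.
(** * Products of one-dimensional heat evolutions *)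

(** Leibniz rule; the [i]-th summand differentiates the [i]-th factor. *)
Lemma is_derive_prod {R : realType} {d : nat} {f : 'I_d -> R -> R}
    {df : 'I_d -> R} {x : R} : (forall l, is_derive x 1 (f l) (df l)) ->
  is_derive x 1 (fun t => \prod_l f l t)
    (\sum_i \prod_l (if l == i then df l else f l x)).
Proof.
elim: d f df => [|d IH] f df Hf.
  rewrite big_ord0; apply: is_derive_fun (is_derive_cst (1 : R) x 1) => t.
  by rewrite big_ord0.
have H := is_derive_mulf (Hf ord0) (IH _ _ (fun l => Hf (lift ord0 l))).
apply: is_derive_fun (is_derive_val H _) => [t|]; first by rewrite big_ord_recl.
rewrite big_ord_recl [in RHS]big_ord_recl eqxx /=; congr (_ + _).
by rewrite mulr_sumr; apply: eq_bigr => i _; rewrite big_ord_recl.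
Qed.

(** The multi-index [m + e_i]. *)
Definition incr {d : nat} (i : 'I_d) (m : 'I_d -> nat) : 'I_d -> nat :=
  fun l => (m l + (l == i))%N.

Lemma sum_incr {d : nat} (i : 'I_d) m : (\sum_l incr i m l = (\sum_l m l).+1)%N.
Proof.
rewrite big_split /= -addn1; congr addn.
by rewrite (bigD1 i)//= eqxx big1 ?addn0// => l /negbTE ->.
Qed.

Section HeatProduct.
Context {R : realType} {d : nat}.
Implicit Types (m : 'I_d -> nat) (y a b : 'I_d -> R) (r t : R).

(** The product over the coordinates [l] of [heat (m l) r (y l)]: the partial
    derivative of multi-index [m] of the [d]-dimensional heat evolution of a
    tensor product of bumps. *)
Definition heatprod m r y : R := \prod_l heat (m l) r (y l).

Lemma prod_incr m r y i (c : R) :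
  \prod_l (if l == i then c * heat (m l).+1 r (y l) else heat (m l) r (y l)) =
  c * heatprod (incr i m) r y.
Proof.
rewrite /heatprod (bigD1 i)//= [in RHS](bigD1 i)//= eqxx mulrA.
congr (_ * _); first by rewrite /incr eqxx addn1.
by apply: eq_bigr => l /negbTE li; rewrite /incr li addn0.
Qed.

Lemma heatprod_derive m r a b t :
  is_derive t 1 (fun t => heatprod m r (fun l => a l + t * b l))
    (\sum_i b i * heatprod (incr i m) r (fun l => a l + t * b l)).
Proof.
have Hl l : is_derive t 1 (fun t => heat (m l) r (a l + t * b l))
    (b l * heat (m l).+1 r (a l + t * b l)).
  have Ht := heat_derive (m l) r (b l * t + a l).
  apply: is_derive_fun (is_derive_val (is_derive_affine _ _ Ht) _).
    by move=> s; rewrite addrC mulrC.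
  by rewrite addrC [t * _]mulrC.
apply: is_derive_val (is_derive_prod Hl) _; apply: eq_bigr => i _.
rewrite -prod_incr; apply: eq_bigr => l _.
by case: eqVneq => // ->.
Qed.

Lemma heatprod_flow m (x v : 'rV[R]_d) r :
  is_derive r 1 (fun r => heatprod m r (fun l => x 0 l - r ^+ 2 * v 0 l))
    (\sum_i (2 * r ^+ 5 *
               heatprod (incr i (incr i m)) r (fun l => x 0 l - r ^+ 2 * v 0 l) -
             2 * r * v 0 i *
               heatprod (incr i m) r (fun l => x 0 l - r ^+ 2 * v 0 l))).
Proof.
apply: is_derive_val (is_derive_prod (fun l => heat_flow (m l) (x 0 l) (v 0 l) r)) _.
apply: eq_bigr => i _; rewrite /heatprod (bigD1 i)//= [in RHS](bigD1 i)//=.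
rewrite [X in _ = _ - _ * X](bigD1 i)//= eqxx /incr eqxx !addn1.
set P := \prod_(l < d | l != i) _.
rewrite (eq_bigr (fun l => heat (m l) r (x 0 l - r ^+ 2 * v 0 l))); last first.
  by move=> l /negbTE ->; rewrite !addn0.
rewrite [X in _ = _ - _ * (_ * X)](eq_bigr (fun l => heat (m l) r (x 0 l - r ^+ 2 * v 0 l))); last first.
  by move=> l /negbTE ->; rewrite !addn0.
have -> : P = \prod_(l < d | l != i) heat (m l) r (x 0 l - r ^+ 2 * v 0 l).
  by apply: eq_bigr => l /negbTE ->.
move: (\prod_(l < d | _) _) (heat _ _ _) (heat _ _ _) => A B C.
by ring.
Qed.

Lemma heatprod_bound m : exists2 C : R, 0 <= C &
  forall r y, (1 + r ^+ 2) ^+ (\sum_l m l) * `|heatprod m r y| <= C.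
Proof.
have /choice[C HC] : forall n, exists C : R, 0 <= C /\
    forall r (z : R), (1 + r ^+ 2) ^+ n * `|heat n r z| <= C.
  by move=> n; have [C C0 HC] := @heat_bound R n; exists C.
exists (\prod_l C (m l)); first by apply: prodr_ge0 => l _; have [] := HC (m l).
move=> r y; rewrite -prodrXr normr_prod -big_split /=.
apply: ler_prod => l _; rewrite mulr_ge0 ?exprn_ge0 ?addr_ge0 ?sqr_ge0//=.
by have [_] := HC (m l).
Qed.

(** Uniform second-order Taylor estimate: a displacement [b] costs
    [|b| ^ 2 / (1 + r ^ 2) ^ 2] in addition to the decay of the product. *)
Lemma heatprod_taylor m : exists2 C : R, 0 <= C &
  forall r a b (B : R), 0 <= B -> (forall l, `|b l| <= (1 + r ^+ 2) * B) ->
  (1 + r ^+ 2) ^+ (\sum_l m l) *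
  `|heatprod m r (fun l => a l + b l) - heatprod m r a -
    \sum_i b i * heatprod (incr i m) r a| <= C * B ^+ 2.
Proof.
have /choice[C HC] : forall ik : 'I_d * 'I_d, exists C : R, 0 <= C /\
    forall r y, (1 + r ^+ 2) ^+ (\sum_l m l).+2 *
      `|heatprod (incr ik.2 (incr ik.1 m)) r y| <= C.
  move=> ik; have [C C0 HC] := heatprod_bound (incr ik.2 (incr ik.1 m)).
  by exists C; split => // r y; have := HC r y; rewrite !sum_incr.
have C0 ik : 0 <= C ik by have [] := HC ik.
exists (\sum_i \sum_k C (i, k)).
  by apply: sumr_ge0 => i _; apply: sumr_ge0.
move=> r a b B B0 Hb; set q := 1 + r ^+ 2; set N := (\sum_l m l)%N.
have q0 : 0 < q by rewrite /q ltr_wpDr// sqr_ge0.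
have qN : 0 < q ^+ N by rewrite exprn_gt0.
(* a bound on the second derivative of the product along the segment *)
pose M := (\sum_i \sum_k C (i, k)) * B ^+ 2 / q ^+ N.
have HM t : `|\sum_i b i * (\sum_k b k *
    heatprod (incr k (incr i m)) r (fun l => a l + t * b l))| <= M.
  rewrite /M -mulrA mulr_suml (le_trans (ler_norm_sum _ _ _))// ler_sum// => i _.
  rewrite mulr_sumr mulr_suml (le_trans (ler_norm_sum _ _ _))// ler_sum// => k _.
  rewrite [leRHS]mulrA ler_pdivlMr//.
  have [_ H] := HC (i, k).
  have := H r (fun l => a l + t * b l); rewrite -/q -/N /= => {}H.
  rewrite !normrM.
  set h := `|heatprod _ _ _| in H *.
  have h0 : 0 <= h by exact: normr_ge0.
  apply: (@le_trans _ _ (q * B * (q * B * h) * q ^+ N)).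
    by rewrite ler_wpM2r ?(ltW qN)// ler_pM ?mulr_ge0// ler_wpM2r.
  have -> : q * B * (q * B * h) * q ^+ N = q ^+ N.+2 * h * B ^+ 2.
    by rewrite 2!exprS; ring.
  by rewrite ler_wpM2r ?sqr_ge0.
have D2 t : is_derive t 1
    (fun t => \sum_i b i * heatprod (incr i m) r (fun l => a l + t * b l))
    (\sum_i b i * (\sum_k b k *
      heatprod (incr k (incr i m)) r (fun l => a l + t * b l))).
  have := @is_derive_sum _ _ _ d
    (fun i t => b i * heatprod (incr i m) r (fun l => a l + t * b l)) t 1 _
    (fun i => is_derive_scalef (b i) (heatprod_derive (incr i m) r a b t)).
  by apply: is_derive_fun => s; rewrite fct_sumE.
have := taylor2 M (heatprod_derive m r a b) D2 HM 0 1.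
rewrite add0r mul1r expr1n mulr1.
have -> : (fun l => a l + 1 * b l) = (fun l => a l + b l).
  by apply/funext => l; rewrite mul1r.
have -> : (fun l => a l + 0 * b l) = a.
  by apply/funext => l; rewrite mul0r addr0.
by rewrite /M ler_pdivlMr// mulrC.
Qed.

End HeatProduct.
(** * Potentials *)

(** The potentials are integrals over the half-line [r >= 0], where [r ^ 2] is
    the kinetic time. The one with [j = 0] and [m = (1, ..., 1)] is the solution
    we are after; the others are its derivatives. The integral converges
    as soon as [j + 2 <= \sum_l m l]. *)
Definition layer {R : realType} {d : nat} (j : nat) (m : 'I_d -> nat)
    (p : 'rV[R]_d * 'rV[R]_d) (r : R) : R :=
  2 * r ^+ (2 * j + 1) * heatprod m r (fun l => p.1 0 l - r ^+ 2 * p.2 0 l).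

Definition potential {R : realType} {d : nat} (j : nat) (m : 'I_d -> nat)
    (p : 'rV[R]_d * 'rV[R]_d) : R := halfint (layer j m p).

Section Potential.
Context {R : realType} {d : nat}.
Implicit Types (m : 'I_d -> nat) (p u : 'rV[R]_d * 'rV[R]_d) (j : nat) (r : R).

Lemma time_weight_bound j r : `|2 * r ^+ (2 * j + 1)| <= (1 + r ^+ 2) ^+ j.+1.
Proof.
have r20 := sqr_ge0 r.
have -> : `|2 * r ^+ (2 * j + 1)| = (r ^+ 2) ^+ j * (2 * `|r|).
  by rewrite exprD expr1 exprM mulrCA normrM normrX ger0_norm// normrM ger0_norm.
rewrite [leRHS]exprSr; apply: ler_pM.
- exact: exprn_ge0.
- exact: mulr_ge0.
- by rewrite lerXn2r ?nnegrE ?addr_ge0// lerDr.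
- rewrite -[r ^+ 2]real_normK ?num_real//.
  by rewrite -subr_ge0 [leRHS](_ : _ = (1 - `|r|) ^+ 2); [exact: sqr_ge0|ring].
Qed.

(** A bound on the product with the weight [(1 + r ^ 2) ^ \sum m] leaves the
    integrable factor [1 / (1 + r ^ 2)] after multiplication by the time
    weight. *)
Lemma time_weight_tame j N r (c C : R) : (j + 2 <= N)%N ->
  (1 + r ^+ 2) ^+ N * `|c| <= C ->
  `|2 * r ^+ (2 * j + 1) * c| <= C * (oneDsqr r)^-1.
Proof.
move=> jN H; have q1 : 1 <= 1 + r ^+ 2 by rewrite lerDl sqr_ge0.
have q0 : 0 < 1 + r ^+ 2 by rewrite (lt_le_trans ltr01).
rewrite /oneDsqr ler_pdivlMr// normrM (le_trans _ H)//.
rewrite mulrAC ler_wpM2r//.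
apply: (@le_trans _ _ ((1 + r ^+ 2) ^+ (j + 2))).
  by rewrite addn2 [leRHS]exprSr ler_wpM2r ?(ltW q0)// time_weight_bound.
by rewrite ler_weXn2l.
Qed.

Lemma layer_continuous j m p : continuous (layer j m p).
Proof.
have c : continuous (fun r => heatprod m r (fun l => p.1 0 l - r ^+ 2 * p.2 0 l)).
  exact: is_derive_continuous (heatprod_flow m p.1 p.2).
move=> r; apply: cvgM; last exact: c.
by apply: cvgMr; exact: exprn_continuous.
Qed.

Lemma layer_tame_by j m : (j + 2 <= \sum_l m l)%N ->
  exists2 C : R, 0 <= C & forall p, tame_by C (layer j m p).
Proof.
move=> jm; have [C C0 HC] := @heatprod_bound R d m; exists C => // p.
split; first exact: layer_continuous.
by move=> r; apply: time_weight_tame jm _; exact: HC.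
Qed.

Lemma layer_tame j m p : (j + 2 <= \sum_l m l)%N -> tame (layer j m p).
Proof. by move=> /layer_tame_by[C _ HC]; exists C; exact: HC. Qed.

Lemma potential_bound j m : (j + 2 <= \sum_l m l)%N ->
  exists2 C : R, 0 <= C & forall p, `|potential j m p| <= C.
Proof.
move=> /layer_tame_by[C C0 HC]; exists (C * dommass).
  by rewrite mulr_ge0// dommass_ge0.
by move=> p; exact: halfint_bound.
Qed.

Lemma admissible_fst j m i :
  (j + 2 <= \sum_l m l)%N -> (j + 2 <= \sum_l incr i m l)%N.
Proof. by rewrite sum_incr => /leqW. Qed.

Lemma admissible_snd j m i :
  (j + 2 <= \sum_l m l)%N -> (j.+1 + 2 <= \sum_l incr i m l)%N.
Proof. by rewrite sum_incr addSn ltnS. Qed.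

(** A derivative in [x_i] raises the multi-index; a derivative in [v_i] also
    multiplies the integrand by [- r ^ 2], which raises [j]. *)
Lemma potential_taylor j m : (j + 2 <= \sum_l m l)%N ->
  exists C : R, forall p u,
  `|potential j m (u + p) - potential j m p -
    pairing (fun i => potential j (incr i m) p)
            (fun i => potential j.+1 (incr i m) p) u| <= C * `|u| ^+ 2.
Proof.
move=> jm; have [C C0 HC] := @heatprod_taylor R d m.
exists (C * dommass) => p u.
have t1 i : tame (layer j (incr i m) p) by apply/layer_tame/admissible_fst.
have t2 i : tame (layer j.+1 (incr i m) p) by apply/layer_tame/admissible_snd.
pose g r := layer j m (u + p) r - layer j m p r -
  \sum_i (u.1 0 i * layer j (incr i m) p r - u.2 0 i * layer j.+1 (incr i m) p r).
have tg : tame g.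
  apply: tameB; first by apply: tameB; exact: layer_tame.
  by apply: tame_sum => i; apply: tameB; exact: tameZ.
have -> : potential j m (u + p) - potential j m p -
    pairing (fun i => potential j (incr i m) p)
            (fun i => potential j.+1 (incr i m) p) u = halfint g.
  rewrite halfintB; first last.
  - by apply: tame_sum => i; apply: tameB; exact: tameZ.
  - by apply: tameB; exact: layer_tame.
  rewrite halfintB; [|exact: layer_tame..].
  rewrite halfint_sum; last by move=> i; apply: tameB; exact: tameZ.
  congr (_ - _); apply: eq_bigr => i _.
  by rewrite halfintB; [rewrite !halfintZ|exact: tameZ..].
rewrite mulrAC; apply: halfint_bound; split; first exact: tame_continuous.
move=> r.
pose a l := p.1 0 l - r ^+ 2 * p.2 0 l.
pose b l := u.1 0 l - r ^+ 2 * u.2 0 l.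
have -> : g r = 2 * r ^+ (2 * j + 1) *
  (heatprod m r (fun l => a l + b l) - heatprod m r a -
   \sum_i b i * heatprod (incr i m) r a).
  rewrite /g /layer mulrBr mulrBr; congr (_ - _ - _).
    congr (_ * heatprod m r _); apply/funext => l.
    have E1 : (u + p).1 0 l = u.1 0 l + p.1 0 l by rewrite mxE.
    have E2 : (u + p).2 0 l = u.2 0 l + p.2 0 l by rewrite mxE.
    by rewrite /a /b E1 E2; ring.
  rewrite mulr_sumr; apply: eq_bigr => i _; rewrite /b -/a.
  have -> : r ^+ (2 * j.+1 + 1) = r ^+ 2 * r ^+ (2 * j + 1).
    by rewrite -exprD mulnS addnA.
  by move: (heatprod _ _ _) => h; ring.
apply: time_weight_tame jm _; apply: HC => // l.
rewrite (le_trans (ler_normB _ _))// mulrDl mul1r lerD//.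
  exact: fst_le_norm.
by rewrite normrM ger0_norm ?sqr_ge0// ler_wpM2l ?sqr_ge0// snd_le_norm.
Qed.

Lemma potential_differentiable j m p : (j + 2 <= \sum_l m l)%N ->
  differentiable (potential j m : 'rV[R]_d * 'rV[R]_d -> R) p.
Proof.
move=> /potential_taylor[C HC].
exact: differentiable_quadratic (pairing_bound _ _) (HC p).
Qed.

Lemma potential_derive j m p u : (j + 2 <= \sum_l m l)%N ->
  'D_u (potential j m : 'rV[R]_d * 'rV[R]_d -> R) p =
  \sum_i (u.1 0 i * potential j (incr i m) p -
          u.2 0 i * potential j.+1 (incr i m) p).
Proof.
move=> /potential_taylor[C HC].
suff [] : is_derive p u (potential j m) (pairing
  (fun i => potential j (incr i m) p) (fun i => potential j.+1 (incr i m) p) u) by [].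
apply: (is_derive_quadratic (C * `|u| ^+ 2)) => h _.
have := HC p (h *: u); rewrite linearZ normrZ exprMn real_normK ?num_real//.
by rewrite mulrCA [leRHS]mulrC.
Qed.

End Potential.

(** * Stability of smoothness *)

Section Smooth.
Context {R : realType}.

Lemma Ck_cst (V : normedModType R) k (c : R) : Ck k (fun _ : V => c).
Proof.
elim: k c => [|k IH] c; first by move=> x; exact: cvg_cst.
split; first by move=> x; exact: differentiable_cst.
move=> u; have -> : 'D_u (fun _ : V => c) = fun _ => 0.
  by apply/funext => x; have := derive_cst c x u.
exact: IH.
Qed.

Lemma CkD {V : normedModType R} {k} {f g : V -> R} :
  Ck k f -> Ck k g -> Ck k (fun x => f x + g x).
Proof.
elim: k f g => [|k IH] f g; first by move=> cf cg x; apply: cvgD; [exact: cf|exact: cg].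
move=> [df sf] [dg sg]; split; first by move=> x; exact: differentiableD.
move=> u; rewrite (_ : 'D_u _ = fun x => 'D_u f x + 'D_u g x).
  exact: (IH _ _ (sf u) (sg u)).
by apply/funext => x; apply: deriveD; exact: diff_derivable.
Qed.

Lemma CkZ {V : normedModType R} {k} {f : V -> R} (c : R) :
  Ck k f -> Ck k (fun x => c * f x).
Proof.
elim: k f => [|k IH] f; first by move=> cf x; apply: cvgMr; exact: cf.
move=> [df sf]; split; first by move=> x; exact: differentiableZ.
move=> u; rewrite (_ : 'D_u _ = fun x => c * 'D_u f x).
  exact: (IH _ (sf u)).
by apply/funext => x; apply: deriveZ; exact: diff_derivable.
Qed.

Lemma Ck_sum {V : normedModType R} {k} (I : Type) (s : seq I) (f : I -> V -> R) :
  (forall i, Ck k (f i)) -> Ck k (fun x => \sum_(i <- s) f i x).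
Proof.
move=> sf; elim: s => [|i s IH].
  by under eq_fun do rewrite big_nil; exact: Ck_cst.
by under eq_fun do rewrite big_cons; exact: CkD.
Qed.

Lemma derive_comp_linear {V W : normedModType R} (A : {linear W -> V})
    (f : V -> R) (u x : W) : 'D_u (f \o A) x = 'D_(A u) f (A x).
Proof.
rewrite /derive.
have -> : (fun h : R => h^-1 *: ((f \o A \o shift x) (h *: u) - (f \o A) x)) =
    (fun h : R => h^-1 *: ((f \o shift (A x)) (h *: A u) - f (A x))).
  by apply/funext => h /=; rewrite linearP.
by [].
Qed.

Lemma Ck_comp_linear {V W : normedModType R} {k} (A : {linear W -> V})
    {f : V -> R} : continuous A -> Ck k f -> Ck k (f \o A).
Proof.
move=> cA; elim: k f => [|k IH] f.
  by move=> cf x; apply: continuous_comp; [exact: cA|exact: cf].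
move=> [df sf]; split.
  by move=> x; apply: differentiable_comp => //; exact: linear_differentiable.
move=> u; rewrite (_ : 'D_u _ = 'D_(A u) f \o A).
  exact: (IH _ (sf (A u))).
by apply/funext => x; exact: derive_comp_linear.
Qed.

Lemma potential_Ck {d : nat} k j (m : 'I_d -> nat) : (j + 2 <= \sum_l m l)%N ->
  Ck k (potential j m : 'rV[R]_d * 'rV[R]_d -> R).
Proof.
elim: k j m => [|k IH] j m jm.
  by move=> p; apply: differentiable_continuous; exact: potential_differentiable.
split; first by move=> p; exact: potential_differentiable.
move=> u; rewrite (_ : 'D_u _ = fun p =>
  \sum_i (u.1 0 i * potential j (incr i m) p +
          (- u.2 0 i) * potential j.+1 (incr i m) p)).
  apply: Ck_sum => i; apply: CkD; apply: CkZ; apply: IH.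
    exact: admissible_fst.
  exact: admissible_snd.
apply/funext => p; rewrite potential_derive//; apply: eq_bigr => i _.
by rewrite mulNr.
Qed.

End Smooth.
(** * The kinetic equation *)

(** The multi-index [(1, ..., 1)]. *)
Definition ones {d : nat} : 'I_d -> nat := fun _ => 1%N.

Lemma sum_ones {d : nat} : (\sum_l @ones d l = d)%N.
Proof. by rewrite /ones sum1_card card_ord. Qed.

(** The source of the potential with [j = 0] and [m = ones]: a product over the
    coordinates of first derivatives of the bump, up to a constant factor. *)
Definition source {R : realType} {d : nat} (x : 'rV[R]_d) : R :=
  heatprod ones 0 (fun l => x 0 l).

Section Equation.
Context {R : realType} {d : nat} (hd : (2 <= d)%N).
Implicit Types (x v : 'rV[R]_d) (p u : 'rV[R]_d * 'rV[R]_d) (r : R).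

Lemma admissible_ones i : (0 + 2 <= \sum_l incr i (@ones d) l)%N.
Proof. by rewrite sum_incr sum_ones add0n leqW. Qed.

Lemma admissible_ones2 i k : (2 + 2 <= \sum_l incr i (incr k (@ones d)) l)%N.
Proof. by rewrite !sum_incr sum_ones. Qed.

(** Along the trajectory [x - r ^ 2 v] the [r]-derivative of the heat product is
    the integrand of the Laplacian in [v] minus that of the transport term;
    integrating it over the half-line leaves minus its value at [r = 0]. *)
Lemma potential_equation x v :
  \sum_i v 0 i * potential 0 (incr i ones) (x, v) =
  \sum_i potential 2 (incr i (incr i ones)) (x, v) + source x.
Proof.
have t1 i : tame (layer 0 (incr i ones) (x, v)).
  by apply: layer_tame; exact: admissible_ones.
have t2 i : tame (layer 2 (incr i (incr i ones)) (x, v)).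
  by apply: layer_tame; exact: admissible_ones2.
pose F r := heatprod ones r (fun l => x 0 l - r ^+ 2 * v 0 l).
pose f r := \sum_i (layer 2 (incr i (incr i ones)) (x, v) r -
                    v 0 i * layer 0 (incr i ones) (x, v) r).
have dF r : is_derive r 1 F (f r).
  apply: is_derive_val (heatprod_flow ones x v r) _.
  apply: eq_bigr => i _; rewrite /layer /= expr1; congr (_ - _).
  by rewrite mulrCA !mulrA.
have tf : tame f by apply: tame_sum => i; apply: tameB => //; exact: tameZ.
have tF : tame F.
  have [C C0 HC] := @heatprod_bound R d ones; exists C; split.
    exact: is_derive_continuous dF.
  move=> r; have q1 : 1 <= 1 + r ^+ 2 by rewrite lerDl sqr_ge0.
  have q0 : 0 < 1 + r ^+ 2 by rewrite (lt_le_trans ltr01).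
  rewrite /oneDsqr ler_pdivlMr// (le_trans _ (HC r (fun l => x 0 l - r ^+ 2 * v 0 l)))//.
  rewrite sum_ones mulrC ler_wpM2r// -[leLHS]expr1 ler_weXn2l//.
  exact: leq_trans hd.
have := halfint_FTC tf tF dF.
rewrite halfint_sum; last by move=> i; apply: tameB => //; exact: tameZ.
have -> : F 0 = source x.
  congr (heatprod ones 0 _); apply/funext => l.
  by rewrite expr0n mul0r subr0.
rewrite (eq_bigr (fun i => potential 2 (incr i (incr i ones)) (x, v) -
    v 0 i * potential 0 (incr i ones) (x, v))); last first.
  by move=> i _; rewrite halfintB//; [rewrite halfintZ|exact: tameZ].
rewrite sumrB => /eqP; rewrite subr_eq => /eqP E.
by rewrite E addrAC addNr add0r.
Qed.

(** At the origin every factor of the mixed derivative is nonnegative, the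
    factor [heat 2] being squared. *)
Lemma mixed_potential_gt0 (i k : 'I_d) : i != k ->
  0 < potential 2 (incr i (incr k ones)) (0 : 'rV[R]_d * 'rV[R]_d).
Proof.
move=> ik.
have P (F : nat -> R) : \prod_l F (incr i (incr k ones) l) =
    F 2%N ^+ 2 * \prod_(l < d | (l != i) && (l != k)) F 1%N.
  rewrite (bigD1 i)//= (bigD1 k)/=; last by rewrite eq_sym.
  have -> : incr i (incr k ones) i = 2%N by rewrite /incr eqxx (negbTE ik).
  have -> : incr i (incr k ones) k = 2%N.
    by rewrite /incr eqxx [k == i]eq_sym (negbTE ik).
  rewrite expr2 mulrA; congr (_ * _); apply: eq_bigr => l /andP[li lk].
  by rewrite /incr (negbTE li) (negbTE lk).
have E r : layer 2 (incr i (incr k ones)) (0 : 'rV[R]_d * 'rV[R]_d) r =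
    2 * r ^+ 5 * (heat 2 r 0 ^+ 2 *
      \prod_(l < d | (l != i) && (l != k)) heat 1 r 0).
  have E0 : (fun l => (0 : 'rV[R]_d * 'rV[R]_d).1 0 l -
      r ^+ 2 * (0 : 'rV[R]_d * 'rV[R]_d).2 0 l) = fun=> 0.
    by apply/funext => l; rewrite !mxE mulr0 subr0.
  rewrite /layer E0; congr (_ * _).
  exact: (P (fun n => heat n r 0)).
apply: (@halfint_gt0 _ _ 1).
- by apply: layer_tame; exact: admissible_ones2.
- move=> r r0; rewrite E; apply: mulr_ge0.
    by apply: mulr_ge0 => //; exact: exprn_ge0.
  apply: mulr_ge0; first exact: sqr_ge0.
  by apply: prodr_ge0 => l _; exact: heat1_ge0.
- exact: ltr01.
- rewrite E expr1n mulr1; apply: mulr_gt0 => //.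
  apply: mulr_gt0; first by rewrite exprn_gt0// heat2_gt0.
  by apply: prodr_gt0 => l _; exact: heat1_gt0.
Qed.

Lemma source_bound : exists2 C : R, 0 <= C & forall x : 'rV[R]_d, `|source x| <= C.
Proof.
have [C C0 HC] := @heatprod_bound R d ones; exists C => // x.
by have := HC 0 (fun l => x 0 l); rewrite expr0n addr0 expr1n mul1r.
Qed.

Lemma source_supp x i : source x != 0 -> 1 <= x 0 i <= 2.
Proof.
rewrite /source /heatprod => /prodf_neq0 /(_ i isT).
by rewrite heat0 mulf_eq0 negb_or => /andP[_]; exact: bump_supp.
Qed.

End Equation.

(** * Superposition of rescaled solutions *)

(** The dilation by [8] in [x] and [2] in [v] of the kinetic scaling: the
    function [4^-k f (8^k x, 2^k v)] has source [g (8^k x)] if [f] has source [g],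
    and its second derivatives in [v] are those of [f] at the dilated point. *)
Definition dilation {R : realType} {d : nat} (k : nat)
    (p : 'rV[R]_d * 'rV[R]_d) : 'rV[R]_d * 'rV[R]_d :=
  (8 ^+ k *: p.1, 2 ^+ k *: p.2).

Lemma dilation_is_linear {R : realType} {d : nat} k :
  linear (@dilation R d k).
Proof.
move=> a p u; rewrite /dilation; congr pair => /=;
  by rewrite scalerDr !scalerA mulrC.
Qed.

HB.instance Definition _ {R : realType} {d : nat} k := GRing.isLinear.Build
  R _ _ _ (@dilation R d k) (dilation_is_linear k).

Lemma dilation_continuous {R : realType} {d : nat} k : continuous (@dilation R d k).
Proof.
move=> p.
have c1 : 8 ^+ k *: q.1 @[q --> p] --> 8 ^+ k *: p.1 by apply: cvgZr; exact: cvg_fst.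
have c2 : 2 ^+ k *: q.2 @[q --> p] --> 2 ^+ k *: p.2 by apply: cvgZr; exact: cvg_snd.
exact: cvg_pair c1 c2.
Qed.

(** A weighted sum of [N] dilated copies of a potential. *)
Definition superpose {R : realType} {d : nat} (N : nat) (w : nat -> R) (j : nat)
    (m : 'I_d -> nat) (p : 'rV[R]_d * 'rV[R]_d) : R :=
  \sum_(k < N) w k * potential j m (dilation k p).

Lemma derive_fst {R : realType} {V W : normedModType R} (f : V * W -> R) e x v :
  'D_e (fun y => f (y, v)) x = 'D_(e, 0) f (x, v).
Proof.
rewrite /derive.
have -> : (fun h : R => h^-1 *: (((fun y => f (y, v)) \o shift x) (h *: e) - f (x, v))) =
    (fun h : R => h^-1 *: ((f \o shift (x, v)) (h *: (e, 0)) - f (x, v))).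
  apply/funext => h /=; congr (_ *: (f _ - _)).
  by congr pair; rewrite /= scaler0 add0r.
by [].
Qed.

Lemma derive_snd {R : realType} {V W : normedModType R} (f : V * W -> R) e x v :
  'D_e (fun w => f (x, w)) v = 'D_(0, e) f (x, v).
Proof.
rewrite /derive.
have -> : (fun h : R => h^-1 *: (((fun w => f (x, w)) \o shift v) (h *: e) - f (x, v))) =
    (fun h : R => h^-1 *: ((f \o shift (x, v)) (h *: (0, e)) - f (x, v))).
  apply/funext => h /=; congr (_ *: (f _ - _)).
  by congr pair; rewrite /= scaler0 add0r.
by [].
Qed.

Section Superpose.
Context {R : realType} {d : nat}.
Implicit Types (x v : 'rV[R]_d) (p u : 'rV[R]_d * 'rV[R]_d) (w : nat -> R)
  (m : 'I_d -> nat) (j N : nat).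

Lemma superpose_smooth N w j m : (j + 2 <= \sum_l m l)%N ->
  smooth (superpose N w j m : 'rV[R]_d * 'rV[R]_d -> R).
Proof.
move=> jm n; apply: Ck_sum => k; apply: CkZ.
exact (Ck_comp_linear (@dilation R d k) (dilation_continuous k) (potential_Ck n j m jm)).
Qed.

Lemma superpose_derive N w j m p u : (j + 2 <= \sum_l m l)%N ->
  'D_u (superpose N w j m : 'rV[R]_d * 'rV[R]_d -> R) p =
  \sum_(k < N) w k * (\sum_i (8 ^+ k * u.1 0 i * potential j (incr i m) (dilation k p) -
     2 ^+ k * u.2 0 i * potential j.+1 (incr i m) (dilation k p))).
Proof.
move=> jm.
pose h (k : 'I_N) := w k \*: (potential j m \o @dilation R d k : 'rV[R]_d * 'rV[R]_d -> R).
have dh k : differentiable (potential j m \o @dilation R d k) p.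
  apply: differentiable_comp; last exact: potential_differentiable.
  exact: linear_differentiable (dilation_continuous k).
have -> : (superpose N w j m : 'rV[R]_d * 'rV[R]_d -> R) = \sum_(k < N) h k.
  by apply/funext => q; rewrite fct_sumE.
rewrite derive_sum; last by move=> k; apply: derivableZ; exact: diff_derivable.
apply: eq_bigr => k _; rewrite deriveZ; last exact: diff_derivable.
rewrite [LHS]/GRing.scale/=; congr (_ * _).
rewrite derive_comp_linear potential_derive//; apply: eq_bigr => i _.
by rewrite !mxE.
Qed.

Lemma superpose_partial_x N w j m p i : (j + 2 <= \sum_l m l)%N ->
  'D_(delta_mx 0 i, 0) (superpose N w j m : 'rV[R]_d * 'rV[R]_d -> R) p =
  superpose N (fun k => w k * 8 ^+ k) j (incr i m) p.
Proof.
move=> jm; rewrite superpose_derive//; apply: eq_bigr => k _.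
rewrite (bigD1 i)//= big1 => [|l /negbTE li]; last first.
  by rewrite !mxE li andbF !mulr0 !mul0r subr0.
by rewrite !mxE !eqxx mulr1 mulr0 mul0r subr0 addr0 mulrA.
Qed.

Lemma superpose_partial_v N w j m p i : (j + 2 <= \sum_l m l)%N ->
  'D_(0, delta_mx 0 i) (superpose N w j m : 'rV[R]_d * 'rV[R]_d -> R) p =
  superpose N (fun k => - (w k * 2 ^+ k)) j.+1 (incr i m) p.
Proof.
move=> jm; rewrite superpose_derive//; apply: eq_bigr => k _.
rewrite (bigD1 i)//= big1 => [|l /negbTE li]; last first.
  by rewrite !mxE li andbF !mulr0 !mul0r subr0.
by rewrite !mxE !eqxx mulr1 mulr0 mul0r sub0r addr0 mulrN mulNr mulrA.
Qed.

Lemma superpose_partial_vv N w j m x v i k : (j + 2 <= \sum_l m l)%N ->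
  partial i (partial k (fun z => superpose N w j m (x, z))) v =
  superpose N (fun n => w n * 4 ^+ n) j.+2 (incr i (incr k m)) (x, v).
Proof.
move=> jm; rewrite /partial.
have -> : 'D_(delta_mx 0 k) (fun z => superpose N w j m (x, z)) =
    fun z => superpose N (fun n => - (w n * 2 ^+ n)) j.+1 (incr k m) (x, z).
  by apply/funext => z; rewrite derive_snd superpose_partial_v.
rewrite derive_snd superpose_partial_v; last exact: admissible_snd.
apply: eq_bigr => n _; congr (_ * _).
by rewrite mulNr opprK -mulrA -exprMn; congr (_ * _ ^+ _); ring.
Qed.

End Superpose.
(** * Essential suprema *)

Section Linfty.
Context {R : realType}.

Lemma Linfty_norm_le {n} (u : 'rV[R]_n -> R) (C : R) : 0 <= C ->
  (forall x, `|u x| <= C) -> (Linfty_norm setT u <= C%:E)%E.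
Proof.
move=> C0 H; rewrite /Linfty_norm unlock /Lnorm; case: ifP => _; last first.
  by rewrite lee_fin.
apply/ess_supP; apply: nearW => t /=.
by rewrite patchT ?inE// lee_fin.
Qed.

Lemma measurable_box {n} (A : set (measurableTypeR R)) : measurable A ->
  measurable [set t : n.-tuple (measurableTypeR R) | forall i, A (tnth t i)].
Proof.
move=> mA; rewrite (_ : [set t | _] = \bigcap_i ((@tnth n _)^~ i @^-1` A)).
  apply: fin_bigcap_measurable => // i _; rewrite -[X in measurable X]setTI.
  exact: measurable_tnth.
by apply/seteqP; split => t /= Ht i; [move=> _|]; exact: Ht.
Qed.

(** A lower bound on a cube around the origin bounds the essential supremum
    from below. *)
Lemma Linfty_norm_ge {n} (A : set 'rV[R]_n) (u : 'rV[R]_n -> R) (a e : R) :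
  0 < e -> (forall x : 'rV[R]_n, (forall i, `|x 0 i| < e) -> A x /\ a <= `|u x|) ->
  (a%:E <= Linfty_norm A u)%E.
Proof.
move=> e0 H; set mu := lebesgue_measure_tuple R n.
pose I : set (measurableTypeR R) := `]- e, e[%classic.
have mI : measurable I by exact: measurable_itv.
pose Q := [set t : n.-tuple (measurableTypeR R) | forall i, I (tnth t i)].
have mQ : measurable Q by exact: measurable_box.
have muI : @lebesgue_measure R I = (2 * e)%:E.
  have ee : - e < e by lra.
  have := @lebesgue_measure_itv R `]- e, e[; rewrite /= lte_fin ee -EFinB.
  by rewrite opprK -mulr2n mulr_natl.
have muQ : (0 < mu Q)%E.
  rewrite /mu /Q (@lebesgue_measure_tuple_rect R n (fun=> I))//.
  rewrite (eq_bigr (fun=> (2 * e)%:E)); last by move=> i _; exact: muI.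
  by rewrite prodEFin lte_fin prodr_gt0// => i _; rewrite mulr_gt0.
have muT : (0 < mu [set: _])%E.
  by rewrite (lt_le_trans muQ)// le_measure ?inE//; exact: measurableT.
rewrite /Linfty_norm unlock /Lnorm -/mu muT leNgt; apply/negP => lta.
have [B [mB B0 sB]] := ess_sup_ge mu
  (abse \o (fun t => ((u \_ A) (tuple_row t))%:E)).
have : (mu Q <= mu B)%E.
  rewrite le_measure ?inE// => t Qt; apply: sB => /= le_sup.
  have := le_lt_trans le_sup lta; rewrite lte_fin ltNge => /negP; apply.
  have [|At au] := H (tuple_row t).
    by move=> i; rewrite mxE; have := Qt i; rewrite /I /= in_itv/= ltr_norml.
  by rewrite patchT ?inE.
by rewrite B0 leNgt muQ.
Qed.

Lemma Linfty_norm2_le {d} (u : 'rV[R]_d * 'rV[R]_d -> R) (C : R) : 0 <= C ->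
  (forall p, `|u p| <= C) -> (Linfty_norm2 setT u <= C%:E)%E.
Proof.
move=> C0 H; rewrite /Linfty_norm2 preimage_setT.
exact (Linfty_norm_le _ C C0 (fun z => H (row_pair z))).
Qed.

Lemma Linfty_norm2_ge {d} (A : set ('rV[R]_d * 'rV[R]_d))
    (u : 'rV[R]_d * 'rV[R]_d -> R) (a e : R) : 0 < e ->
  (forall x v : 'rV[R]_d, (forall i, `|x 0 i| < e) -> (forall i, `|v 0 i| < e) ->
     A (x, v) /\ a <= `|u (x, v)|) ->
  (a%:E <= Linfty_norm2 A u)%E.
Proof.
move=> e0 H; apply: (Linfty_norm_ge _ _ _ e) => // z Hz.
by apply: H => i; rewrite mxE; exact: Hz.
Qed.

Lemma frobenius_norm_ge {m n} (M : 'M[R]_(m, n)) i j :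
  `|M i j| <= frobenius_norm M.
Proof.
rewrite /frobenius_norm -[leLHS]ger0_norm// -sqrtr_sqr ler_wsqrtr//.
rewrite (bigD1 i)//= (bigD1 j)//= -addrA lerDl addr_ge0//.
  by apply: sumr_ge0 => k _; exact: sqr_ge0.
by apply: sumr_ge0 => k _; apply: sumr_ge0 => l _; exact: sqr_ge0.
Qed.

(** A cube of small side lies in a given Euclidean ball. *)
Lemma euclidean_ball_cube {d} (r : R) : 0 < r ->
  exists2 e : R, 0 < e &
    forall x : 'rV[R]_d, (forall i, `|x 0 i| < e) -> euclidean_ball r x.
Proof.
move=> r0; have D0 : 0 < d%:R + 1 :> R by rewrite ltr_wpDl.
exists (r / (d%:R + 1)); first by rewrite divr_gt0.
move=> x Hx; rewrite /euclidean_ball /=.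
rewrite -[ltRHS]ger0_norm ?ltW// -sqrtr_sqr ltr_sqrt ?exprn_gt0//.
apply: (@le_lt_trans _ _ (\sum_(i < d) (r / (d%:R + 1)) ^+ 2)).
  apply: ler_sum => i _; rewrite -[x 0 i ^+ 2]real_normK ?num_real//.
  have c0 : 0 <= r / (d%:R + 1) by apply/ltW/divr_gt0.
  by rewrite lerXn2r ?nnegrE//; exact/ltW/Hx.
rewrite sumr_const card_ord.
have D1 : 0 <= d%:R :> R by [].
have -> : (r / (d%:R + 1)) ^+ 2 *+ d = r ^+ 2 * (d%:R / (d%:R + 1) ^+ 2).
  by rewrite -mulr_natl; field; rewrite gt_eqF.
by rewrite gtr_pMr ?exprn_gt0// ltr_pdivrMr ?exprn_gt0// mul1r; nra.
Qed.

End Linfty.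
(** * The family of solutions *)

(** The embedding of the points with zero velocity. *)
Definition at_rest {R : realType} {d : nat} (x : 'rV[R]_d) :
  'rV[R]_d * 'rV[R]_d := (x, 0).

Lemma at_rest_is_linear {R : realType} {d : nat} : linear (@at_rest R d).
Proof. by move=> a x y; congr pair; rewrite /= scaler0 addr0. Qed.

HB.instance Definition _ {R : realType} {d : nat} := GRing.isLinear.Build
  R _ _ _ (@at_rest R d) at_rest_is_linear.

Section Family.
Context {R : realType} {d : nat} (hd : (2 <= d)%N).
Implicit Types (x v : 'rV[R]_d) (p : 'rV[R]_d * 'rV[R]_d) (N : nat) (delta : R).

(** The weights [delta / 4 ^ k]. *)
Definition weight delta (k : nat) : R := delta * 4^-1 ^+ k.

(** The solution with [N] scales; its source is [total_source delta N]. *)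
Definition solution delta N p : R := superpose N (weight delta) 0 ones p.

Definition total_source delta N x : R := \sum_(k < N) delta * source (8 ^+ k *: x).

Lemma weight4 delta k : weight delta k * 4 ^+ k = delta.
Proof. by rewrite /weight -mulrA -exprMn mulVf// expr1n mulr1. Qed.

Lemma admissible_one : (0 + 2 <= \sum_l @ones d l)%N.
Proof. by rewrite sum_ones. Qed.

Lemma solution_smooth delta N : smooth (solution delta N).
Proof. exact: superpose_smooth admissible_one. Qed.

Lemma solution_bound delta : 0 <= delta ->
  exists2 C : R, 0 < C & forall N p, `|solution delta N p| <= C.
Proof.
move=> delta0; have [C C0 HC] := @potential_bound R d _ _ admissible_one.
exists (delta * C * 2 + 1); first by rewrite ltr_wpDl// !mulr_ge0.
move=> N p; rewrite (le_trans (ler_norm_sum _ _ _))//.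
apply: (@le_trans _ _ (\sum_(k < N) delta * C * 4^-1 ^+ k)).
  apply: ler_sum => k _; rewrite normrM /weight.
  have q0 : 0 <= 4^-1 ^+ k :> R by rewrite exprn_ge0// invr_ge0.
  have w0 : 0 <= delta * 4^-1 ^+ k by exact: mulr_ge0.
  by rewrite ger0_norm// [leRHS]mulrAC ler_wpM2l.
rewrite -mulr_sumr.
have geom n : \sum_(k < n) 4^-1 ^+ k <= 2 - 2 * 4^-1 ^+ n :> R.
  elim: n => [|n IH]; first by rewrite big_ord0 expr0 mulr1 subrr.
  rewrite big_ord_recr /= exprS.
  have q0 : 0 <= 4^-1 ^+ n :> R by rewrite exprn_ge0// invr_ge0.
  by move: (\sum_(i < n) _) (4^-1 ^+ n) IH q0 => S q IH q0; lra.
have q0 : 0 <= 4^-1 ^+ N :> R by rewrite exprn_ge0// invr_ge0.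
have dC : 0 <= delta * C by rewrite mulr_ge0.
have := geom N; move: (\sum_(i < N) _) => S HS.
rewrite (@le_trans _ _ (delta * C * 2))//; last by rewrite lerDl.
by rewrite ler_wpM2l//; lra.
Qed.

Lemma solution_partial_vv delta N x v i k :
  partial i (partial k (fun z => solution delta N (x, z))) v =
  superpose N (fun n => weight delta n * 4 ^+ n) 2 (incr i (incr k ones)) (x, v).
Proof. exact: (superpose_partial_vv _ _ _ _ _ _ _ _ admissible_one). Qed.

Lemma solution_equation delta N x v :
  \sum_i v 0 i * partial i (fun y => solution delta N (y, v)) x =
  laplacian (fun z => solution delta N (x, z)) v + total_source delta N x.
Proof.
rewrite (eq_bigr (fun i => \sum_(k < N) delta *
    ((2 ^+ k *: v) 0 i * potential 0 (incr i ones) (dilation k (x, v)))));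
  last first.
  move=> i _; rewrite /partial derive_fst superpose_partial_x; last exact: admissible_one.
  rewrite mulr_sumr; apply: eq_bigr => k _.
  rewrite -[in RHS](weight4 delta k) mxE.
  have -> : 8 ^+ k = 4 ^+ k * 2 ^+ k :> R by rewrite -exprMn; congr (_ ^+ _); ring.
  by move: (potential _ _ _) => F; ring.
rewrite /laplacian [X in _ = X + _](eq_bigr (fun i => \sum_(k < N) delta *
    potential 2 (incr i (incr i ones)) (dilation k (x, v)))); last first.
  move=> i _; rewrite solution_partial_vv.
  by apply: eq_bigr => k _; rewrite weight4.
rewrite /total_source exchange_big [X in _ = X + _]exchange_big -big_split /=.
apply: eq_bigr => k _; rewrite -[LHS]mulr_sumr.
have E := potential_equation hd (8 ^+ k *: x) (2 ^+ k *: v).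
rewrite -/(dilation k (x, v)) in E.
rewrite -[X in _ = X + _]mulr_sumr.
rewrite -mulrDr.
exact (congr1 (fun z => delta * z) E).
Qed.

(** The source is recovered from the equation at [v = 0]. *)
Lemma total_source_smooth delta N : smooth (total_source delta N).
Proof.
have E x : total_source delta N x = \sum_i -1 *
    superpose N (fun k => weight delta k * 4 ^+ k) 2 (incr i (incr i ones)) (x, 0).
  have := solution_equation delta N x 0.
  rewrite big1 => [|i _]; last by rewrite mxE mul0r.
  move/eqP; rewrite eq_sym addrC addr_eq0 => /eqP ->.
  rewrite /laplacian -sumrN; apply: eq_bigr => i _.
  by rewrite solution_partial_vv mulN1r.
rewrite (funext E) => n; apply: Ck_sum => i; apply: CkZ.
have ct : continuous (@at_rest R d).
  move=> x; have c1 : id y @[y --> x] --> x by [].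
  exact: cvg_pair c1 (@cst_continuous _ _ (0 : 'rV[R]_d) x).
apply: (Ck_comp_linear (@at_rest R d) ct).
by apply: superpose_smooth; exact: admissible_ones2.
Qed.

Lemma total_source_supp delta N x :
  total_source delta N x != 0 -> forall i, 0 <= x 0 i <= 2.
Proof.
move=> H i; apply: contra_neqT H => out; apply: big1 => k _.
suff -> : source (8 ^+ k *: x) = 0 by rewrite mulr0.
apply: contraNeq out => s; have := source_supp _ i s; rewrite mxE => /andP[s1 s2].
have e0 : 0 < 8 ^+ k :> R by rewrite exprn_gt0.
have x0 : 0 < x 0 i by rewrite -(pmulr_rgt0 _ e0) (lt_le_trans ltr01).
rewrite ltW//= (le_trans _ s2)// ler_peMl ?(ltW x0)//.
by rewrite exprn_ege1// ler1n.
Qed.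

Lemma total_source_compactly_supported delta N :
  compactly_supported (total_source delta N).
Proof.
apply: bounded_closed_compact; last exact: closed_closure.
exists 2; split; first exact: num_real.
move=> M M2 x clx.
have box_closed i : closed [set y : 'rV[R]_d | 0 <= y 0 i <= 2].
  rewrite (_ : [set y | _] = (fun y : 'rV[R]_d => y 0 i) @^-1` `[0, 2]).
    by apply: closed_comp => [y _|]; [exact: coord_continuous|exact: interval_closed].
  by apply/seteqP; split => y /=; rewrite in_itv.
have bx i : 0 <= x 0 i <= 2.
  apply: (box_closed i); apply: closure_subset clx => y /= Hy.
  exact: total_source_supp Hy i.
rewrite /= [leLHS]/Num.norm/= mx_normrE; apply/bigmax_leP; split.
  by rewrite (le_trans _ (ltW M2)).
move=> [a b] _ /=; rewrite ord1; have /andP[b0 b2] := bx b.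
by rewrite ger0_norm// (le_trans b2)// ltW.
Qed.

(** The dilates by different powers of [8] of a point cannot both lie in
    [[1, 2]]. *)
Lemma octave_sep {F : realFieldType} (m n : nat) (y : F) : (m < n)%N ->
  1 <= 8 ^+ m * y -> 8 ^+ n * y <= 2 -> False.
Proof.
move=> mn h1 h2.
have E1 : 1 <= 8 ^+ (n - m.+1) :> F by rewrite exprn_ege1// ler1n.
have E : 8 ^+ n * y = 8 * (8 ^+ (n - m.+1) * (8 ^+ m * y)).
  by rewrite -{1}(subnKC mn) exprD exprS; ring.
rewrite E in h2.
have : 1 <= 8 ^+ (n - m.+1) * (8 ^+ m * y) by rewrite -[leLHS]mulr1 ler_pM.
by move: (8 ^+ (n - m.+1) * _) h2 => z; lra.
Qed.

(** The rescaled sources have disjoint supports. *)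
Lemma total_source_bound delta (M : R) N x : 0 <= delta ->
  (forall x, `|source x| <= M) -> delta * M <= 1 ->
  `|total_source delta N x| <= 1.
Proof.
move=> delta0 HM dM; rewrite /total_source -mulr_sumr.
have M0 : 0 <= M := le_trans (normr_ge0 _) (HM 0).
rewrite normrM ger0_norm// (le_trans _ dM)// ler_wpM2l//.
have [/existsP[k0 k0P]|/existsPn none] :=
    boolP [exists k : 'I_N, source (8 ^+ k *: x) != 0]; last first.
  by rewrite big1 ?normr0// => k _; have := none k; rewrite negbK => /eqP.
rewrite (bigD1 k0)//= big1 ?addr0//= => k kk0; apply/eqP; apply: contraT => kP.
pose i0 : 'I_d := Ordinal (ltnW hd).
have /andP[a1 a2] := source_supp _ i0 k0P; have /andP[b1 b2] := source_supp _ i0 kP.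
rewrite !mxE in a1 a2 b1 b2.
have [lt_k|lt_k|eq_k] := ltngtP k k0.
- by case: (octave_sep _ _ _ lt_k b1 a2).
- by case: (octave_sep _ _ _ lt_k a1 b2).
- by rewrite (ord_inj eq_k) eqxx in kk0.
Qed.

Lemma solution_hessian delta N (i k : 'I_d) p :
  hessian (fun z => solution delta N (p.1, z)) p.2 i k =
  superpose N (fun n => weight delta n * 4 ^+ n) 2 (incr i (incr k ones)) p.
Proof.
by rewrite mxE solution_partial_vv; case: p.
Qed.

(** All the scales contribute equally at the origin. *)
Lemma solution_hessian0 delta N (i k : 'I_d) :
  superpose N (fun n => weight delta n * 4 ^+ n) 2 (incr i (incr k ones)) 0 =
  N%:R * (delta * potential 2 (incr i (incr k ones)) (0 : 'rV[R]_d * 'rV[R]_d)).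
Proof.
rewrite /superpose (eq_bigr (fun=> delta *
    potential 2 (incr i (incr k ones)) (0 : 'rV[R]_d * 'rV[R]_d))); last first.
  move=> n _; rewrite weight4; congr (_ * potential _ _ _).
  by rewrite /dilation; congr pair; rewrite /= scaler0.
by rewrite sumr_const card_ord mulr_natl.
Qed.

End Family.

(** The mixed derivative is continuous, so its value at the origin bounds the
    essential supremum over any neighbourhood. *)
Lemma hessian_Linfty_ge {R : realType} {d : nat} (hd : (2 <= d)%N) (delta : R)
    (N : nat) (i k : 'I_d) (a : R) :
  a < N%:R * (delta * potential 2 (incr i (incr k ones)) (0 : 'rV[R]_d * 'rV[R]_d)) ->
  (a%:E <= Linfty_norm2 (euclidean_ball (1 / 4) `*` euclidean_ball (1 / 4))
    (fun p : 'rV[R]_d * 'rV[R]_d => frobenius_norm (hessian (fun z => solution delta N (p.1, z)) p.2)))%E.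
Proof.
move=> Ha.
pose h := superpose N (fun n => weight delta n * 4 ^+ n) 2 (incr i (incr k ones)).
have ch : continuous (h : 'rV[R]_d * 'rV[R]_d -> R).
  exact: (superpose_smooth N _ 2 (incr i (incr k ones)) (admissible_ones2 hd i k) 0%N).
have [e1 e10 He1] : exists2 e : R, 0 < e & forall x v : 'rV[R]_d,
    (forall l, `|x 0 l| < e) -> (forall l, `|v 0 l| < e) -> a < h (x, v).
  have : \forall q \near (0 : 'rV[R]_d * 'rV[R]_d), a < h q.
    by apply: (cvgr_gt (h 0) (ch 0)); rewrite /h solution_hessian0.
  move=> /nbhs_ballP[e /= e0 He]; exists e => // x v Hx Hv.
  by apply: He; split; rewrite /= mx_norm_ball /ball_ /= sub0r normrN [ltLHS]/Num.norm/= mx_normrE;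
    apply/bigmax_ltP; split => // -[u l] _ /=; rewrite ord1.
have r0 : 0 < 1 / 4 :> R by rewrite divr_gt0.
have [e2 e20 He2] := @euclidean_ball_cube R d _ r0.
apply: (Linfty_norm2_ge _ _ _ (Num.min e1 e2)); first by rewrite lt_min e10.
move=> x v Hx Hv; split.
  by split; apply: He2 => l; [have := Hx l|have := Hv l]; rewrite lt_min => /andP[].
have hxv : a < h (x, v).
  by apply: He1 => l; [have := Hx l|have := Hv l]; rewrite lt_min => /andP[].
rewrite (le_trans (ltW hxv))// (le_trans (ler_norm _))//.
rewrite /h -(solution_hessian hd delta N i k (x, v)).
by rewrite (le_trans (frobenius_norm_ge _ _ _))// ler_norm.
Qed.
Theorem theorem4p1 (R : realType) (d : nat) (hd : (2 <= d)%N) :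
  exists (C c : R) (g : R -> 'rV[R]_d -> R)
      (f : R -> 'rV[R]_d * 'rV[R]_d -> R),
    [/\ 0 < C, 0 < c &
      forall eps : R, 0 < eps -> eps < 1 / 10 ->
        (smooth (g eps) /\ compactly_supported (g eps)) /\
        (smooth (f eps) /\
         kinetic_solution (fun p : R * ('rV[R]_d * 'rV[R]_d) => f eps p.2)
           (fun p => g eps p.2.1)) /\
        (Linfty_norm setT (g eps) <= 1)%E /\
        (Linfty_norm2 setT (f eps) <= C%:E)%E /\
        ((c * ln (1 / eps))%:E <=
          Linfty_norm2 (euclidean_ball (1 / 4) `*` euclidean_ball (1 / 4))
            (fun p => frobenius_norm (hessian (fun w => f eps (p.1, w)) p.2)))%E].
Proof.
pose i0 : 'I_d := Ordinal (ltnW hd); pose i1 : 'I_d := Ordinal hd.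
pose theta := potential 2 (incr i0 (incr i1 ones)) (0 : 'rV[R]_d * 'rV[R]_d).
have theta0 : 0 < theta by exact: mixed_potential_gt0.
have [M M0 HM] := @source_bound R d.
(* makes the source at most [1], also when [M] is small *)
pose delta := (M + 1)^-1.
have delta0 : 0 < delta by rewrite invr_gt0 ltr_wpDl.
have dM : delta * M <= 1 by rewrite mulrC ler_pdivrMr ?ltr_wpDl// mul1r lerDl.
have [C C0 HC] := @solution_bound R d hd delta (ltW delta0).
(* the number of scales, more than [ln (1 / eps)] *)
pose N (eps : R) := (Num.truncn (ln (1 / eps))).+1.
exists C, (delta * theta), (fun eps => total_source delta (N eps)),
  (fun eps => solution delta (N eps)).
split=> [//||eps eps0 eps1]; first exact: mulr_gt0.
split; [|split; [|split; [|split]]].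
- by split; [exact: total_source_smooth|exact: total_source_compactly_supported].
- split; first exact: solution_smooth.
  move=> t x v; have D : derive1 (fun _ : R => solution delta (N eps) (x, v)) t = 0.
    exact: derive1_cst.
  rewrite /= D add0r -solution_equation//.
  by apply: eq_bigr => i _; rewrite mxE.
- by apply: Linfty_norm_le => // x; exact: total_source_bound (ltW delta0) HM dM.
- by apply: Linfty_norm2_le => //; exact: ltW.
- apply: (hessian_Linfty_ge hd delta (N eps) i0 i1).
  have lnN : ln (1 / eps) < (N eps)%:R by exact: truncnS_gt.
  by rewrite mulrC ltr_pM2r// mulr_gt0.
Qed.
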